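(* Let $H\in(0,1)$ and fix $T_0>0$. Let $\nu=\nu_\varepsilon>0$ and $\sigma=\sigma_\varepsilon>0$ satisfy $\nu=\mathcal{O}(\varepsilon^2)$, $\sigma=\mathcal{O}(\varepsilon^{2H+1})$ and $\sigma\nu^{-\frac12-H}=\mathcal{O}(1)$. Consider the scalar stochastic differential equation $$\mathrm{d}b=(b+\mathcal{F}_c(b))\,\mathrm{d}T+\frac{\sigma}{\nu^{\frac12+H}}\,\mathrm{d}\beta^H_{\nu^H}(T),\qquad b(0)=b_0,$$ and its finite-time Lyapunov exponent $\lambda_T(b_0)=\frac1T\ln\Big(\exp\Big(T+\int_0^T D\mathcal{F}_c(b(s))\,\mathrm{d}s\Big)\Big)$. Then there is an $\eta>0$ such that for every deterministic initial condition $b_0$ with $|b_0|<\eta$, $$\mathbb{P}\Big(\lambda_T(b_0)\ge\tfrac14\Big)>0\qquad\text{for all }T\in(0,T_0].$$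
   Context: $\mathcal{H}$ is a separable Hilbert space and $A$ a symmetric non-positive linear operator generating a compact analytic semigroup on $\mathcal{H}$, with one-dimensional kernel $\mathcal{N}$, identified with $\mathbb{R}$ through a unit vector. $P_c$ is the orthogonal projection onto $\mathcal{N}$. For $\alpha\ge 0$, $\mathcal{H}^\alpha=D((1-A)^\alpha)$, and $\mathcal{H}^{-\alpha}$ is the dual of $\mathcal{H}^\alpha$. $X$ is a Banach space with $\mathcal{H}^\alpha\subset X\subset\mathcal{H}$ continuously and densely for some $\alpha\in(0,1/2)$. $\mathcal{F}:X\to X^*\subset\mathcal{H}^{-\alpha}$ is a cubic nonlinearity, $\mathcal{F}(u)=\mathcal{F}(u,u,u)$ with $\mathcal{F}(\cdot,\cdot,\cdot)$ trilinear, satisfying $\langle\mathcal{F}(u)-\mathcal{F}(v),u-v\rangle\le -c\|u-v\|_X^4$ for all $u,v\in X$ and some $c>0$. $\mathcal{F}_c:=P_c\mathcal{F}$ restricted to $\mathcal{N}\cong\mathbb{R}$; it has the form $\mathcal{F}_c(b)=-c_0b^3$ with $c_0>0$, so that $D\mathcal{F}_c(b)=-3c_0b^2$. $\beta^H$ is an $\mathcal{N}$-valued (i.e. scalar) fractional Brownian motion with Hurst index $H$, and for $\gamma>0$, $\beta^H_\gamma(T)=\gamma^{2H}\beta^H(T\gamma^{-2})$, which is again a fractional Brownian motion with the same law. $F_\varepsilon=\mathcal{O}(f_\varepsilon)$ means there are $\varepsilon$-independent $C,\varepsilon_0>0$ with $|F_\varepsilon|\le Cf_\varepsilon$ for all $\varepsilon\in(0,\varepsilon_0]$.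 *)

(* Defs.v *)
From HB Require Import structures.
From mathcomp Require Import all_boot all_order all_algebra sesquilinear ring.
From mathcomp Require Import all_classical all_reals all_analysis.

Set Implicit Arguments.
Unset Strict Implicit.
Unset Printing Implicit Defensive.
Import Order.TTheory GRing.Theory Num.Theory.
Import numFieldNormedType.Exports.
Local Open Scope classical_set_scope.
Local Open Scope ring_scope.

Section AbstractSetting.
Context {R : realType}.
Implicit Types V X : completeNormedModType R.

Definition is_hilbert V (dot : {dot V for idfun}) :=
  forall x, `|x| ^+ 2 = dot x x.

Definition separable V := exists2 B : set V, countable B & dense B.

(* An unbounded operator is a total function A together with its domain D;
   the values of A outside D are irrelevant. *)
Definition linear_operator V (D : set V) (A : V -> V) :=
  D 0 /\ forall (a : R) x y, D x -> D y ->
    D (a *: x + y) /\ A (a *: x + y) = a *: A x + A y.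

Definition symmetric_operator V (dot : {dot V for idfun}) (D : set V)
    (A : V -> V) :=
  forall x y, D x -> D y -> dot (A x) y = dot x (A y).

Definition nonpositive_operator V (dot : {dot V for idfun}) (D : set V)
    (A : V -> V) :=
  forall x, D x -> dot (A x) x <= 0.

Definition c0_semigroup V (S : R -> {linear V -> V}) :=
  [/\ forall t, 0 <= t -> continuous (S t),
      forall x, S 0 x = x,
      forall s t x, 0 <= s -> 0 <= t -> S (s + t) x = S s (S t x) &
      forall x, S t x @[t --> 0^'+] --> x].

Definition generates V (D : set V) (A : V -> V) (S : R -> {linear V -> V}) :=
  c0_semigroup S /\
  forall x y, (D x /\ A x = y) <->
    (t^-1 *: (S t x - x) @[t --> 0^'+] --> y).

Definition compact_semigroup V (S : R -> {linear V -> V}) :=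
  forall t, 0 < t -> precompact (S t @` [set x | `|x| <= 1]).

(* The sector {z = p + iq : p > 0, |q| < k p}, with z encoded as (p, q). *)
Definition sector (k : R) : set (R * R) :=
  [set z | 0 < z.1 /\ `|z.2| < k * z.1].

(* S extends to a holomorphic semigroup on a sector. Since V is a real space,
   the extension acts on the complexification V + iV: Tre z and Tim z are the
   real and imaginary parts of the operator T(z) applied to real vectors, and
   holomorphy is real differentiability plus the Cauchy-Riemann equations. *)
Definition analytic_semigroup V (S : R -> {linear V -> V}) :=
  exists (k : R) (Tre Tim : R * R -> {linear V -> V}),
    [/\ 0 < k,
        forall t x, 0 < t -> Tre (t, 0) x = S t x /\ Tim (t, 0) x = 0,
        forall z, sector k z -> continuous (Tre z) /\ continuous (Tim z),
        forall z w x, sector k z -> sector k w ->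
          Tre (z.1 + w.1, z.2 + w.2) x
            = Tre z (Tre w x) - Tim z (Tim w x) /\
          Tim (z.1 + w.1, z.2 + w.2) x
            = Tre z (Tim w x) + Tim z (Tre w x) &
        (forall z x, sector k z ->
          [/\ differentiable (fun z' : R * R => Tre z' x) z,
              differentiable (fun z' : R * R => Tim z' x) z,
              'D_(1, 0) (fun z' : R * R => Tre z' x) z
                = 'D_(0, 1) (fun z' : R * R => Tim z' x) z &
              'D_(0, 1) (fun z' : R * R => Tre z' x) z
                = - 'D_(1, 0) (fun z' : R * R => Tim z' x) z]) /\
        (forall x,
          Tre z x @[z --> within (sector k) (nbhs ((0, 0) : R * R))] --> x /\
          Tim z x @[z --> within (sector k) (nbhs ((0, 0) : R * R))] --> 0)].

(* y = (1 - A)^(-al) x for al > 0, A being the generator of S, i.e.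
   Gamma(al) y = \int_0^oo t^(al - 1) e^(-t) S(t) x dt, the vector-valued
   integral being tested against every z. *)
Definition frac_resolvent V (dot : {dot V for idfun})
    (S : R -> {linear V -> V}) (al : R) (x y : V) :=
  forall z : V,
    (\int[lebesgue_measure]_(t in `]0%R, +oo[) (t `^ (al - 1) * expR (- t)))
      * dot y z
    = \int[lebesgue_measure]_(t in `]0%R, +oo[)
        (t `^ (al - 1) * expR (- t) * dot (S t x) z).

(* H^al < X < V continuously and densely, X being embedded into V by j.
   H^al = D((1 - A)^al) is the range of (1 - A)^(-al), and the norm of
   y = (1 - A)^(-al) x in H^al is the norm of x in V. *)
Definition interpolates V (dot : {dot V for idfun})
    (S : R -> {linear V -> V}) (al : R) X (j : {linear X -> V}) :=
  [/\ injective j, continuous j, dense (range j),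
      exists C : R, forall x y, frac_resolvent dot S al x y ->
        exists2 u : X, j u = y & `|u| <= C * `|x| &
      dense [set u : X | exists x, frac_resolvent dot S al x (j u)]].

(* F u v w z stands for the pairing <F(u, v, w), z> of F(u, v, w) in X^* with
   z in X. *)
Definition trilinear_to_dual X (F : X -> X -> X -> X -> R) :=
  [/\ forall a u u' v w z, F (a *: u + u') v w z = a * F u v w z + F u' v w z,
      forall a u v v' w z, F u (a *: v + v') w z = a * F u v w z + F u v' w z,
      forall a u v w w' z, F u v (a *: w + w') z = a * F u v w z + F u v w' z,
      forall a u v w z z', F u v w (a *: z + z') = a * F u v w z + F u v w z' &
      forall u v w, continuous (F u v w)].

Definition strongly_dissipative X (F : X -> X -> X -> X -> R) :=
  exists2 c : R, 0 < c &
    forall u v, F u u u (u - v) - F v v v (u - v) <= - c * `|u - v| ^+ 4.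

(* e is the vector of X whose image in V is the unit vector through which the
   kernel of A is identified with the real line. *)
Definition kernel_unit_vector V (D : set V) (A : V -> V) X
    (j : {linear X -> V}) (e : X) :=
  `|j e| = 1 /\ forall x, (D x /\ A x = 0) <-> exists b : R, x = b *: j e.

(* F_c = P_c F on the kernel of A, in the coordinate b |-> b e. The projection
   P_c v = <v, e> e extends to X^* by the pairing: P_c phi = <phi, e> e. *)
Definition Fc X (F : X -> X -> X -> X -> R) (e : X) (b : R) : R :=
  F (b *: e) (b *: e) (b *: e) e.

Lemma Fc_cubic X (F : X -> X -> X -> X -> R) (e : X) (b : R) :
  trilinear_to_dual F -> Fc F e b = F e e e e * b ^+ 3.
Proof.
move=> [l1 l2 l3 _ _].
have z1 v w z : F 0 v w z = 0.
  by have := l1 1 0 0 v w z; rewrite scaler0 addr0 mul1r => /eqP;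
     rewrite -subr_eq0 opprD addrA subrr sub0r oppr_eq0 => /eqP.
have z2 u w z : F u 0 w z = 0.
  by have := l2 1 u 0 0 w z; rewrite scaler0 addr0 mul1r => /eqP;
     rewrite -subr_eq0 opprD addrA subrr sub0r oppr_eq0 => /eqP.
have z3 u v z : F u v 0 z = 0.
  by have := l3 1 u v 0 0 z; rewrite scaler0 addr0 mul1r => /eqP;
     rewrite -subr_eq0 opprD addrA subrr sub0r oppr_eq0 => /eqP.
have h1 v w z : F (b *: e) v w z = b * F e v w z.
  by have := l1 b e 0 v w z; rewrite z1 !addr0.
have h2 u w z : F u (b *: e) w z = b * F u e w z.
  by have := l2 b u e 0 w z; rewrite z2 !addr0.
have h3 u v z : F u v (b *: e) z = b * F u v e z.
  by have := l3 b u v e 0 z; rewrite z3 !addr0.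
by rewrite /Fc h1 h2 h3; ring.
Qed.

Lemma Fc1_lt0 X (F : X -> X -> X -> X -> R) (e : X) :
  trilinear_to_dual F -> strongly_dissipative F -> e != 0 -> F e e e e < 0.
Proof.
move=> trF [c c0 dF] e0; have := dF e 0; rewrite subr0.
have -> : F 0 0 0 e = 0 by have := Fc_cubic e 0 trF; rewrite /Fc scale0r
  expr0n mulr0.
rewrite subr0 => /le_lt_trans; apply.
by rewrite mulNr oppr_lt0 mulr_gt0// exprn_gt0// normr_gt0.
Qed.

End AbstractSetting.

Section Probability.
Context {R : realType} {d : measure_display} {Om : measurableType d}.
Variable P : probability Om R.

(* Degenerate normal laws are Dirac masses and have to be listed separately:
   normal_prob is defined by a density, with a junk value at s = 0. *)
Definition normally_distributed (X : Om -> R) :=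
  (exists m : R, forall B : set R, measurable B -> P (X @^-1` B) = \d_m B) \/
  (exists m s : R, 0 < s /\
     forall B : set R, measurable B -> P (X @^-1` B) = normal_prob m s B).

Definition gaussian_process (X : R -> {RV P >-> R}) :=
  forall (n : nat) (a t : 'I_n -> R), (forall i, 0 <= t i) ->
    normally_distributed (fun w => \sum_(i < n) a i * X (t i) w).

(* Time is restricted to [0, +oo[. *)
Definition fractional_brownian_motion (H : R) (beta : R -> {RV P >-> R}) :=
  [/\ gaussian_process beta,
      forall t, 0 <= t -> ('E_P[beta t] = 0)%E,
      forall s t, 0 <= s -> 0 <= t ->
        covariance P (beta s) (beta t)
        = ((s `^ (2 * H) + t `^ (2 * H) - `|t - s| `^ (2 * H)) / 2)%:E &
      {ae P, forall w, {within `[0, +oo[, continuous (beta ^~ w)}}].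

End Probability.

Section AmplitudeEquation.
Context {R : realType}.

Definition rescale (H g : R) (beta : R -> R) (T : R) : R :=
  g `^ (2 * H) * beta (T * g ^- 2).

(* b is a pathwise solution on [0, T0] of
   db = (b + f(b)) dT + s dxi(T), b(0) = b0. *)
Definition solves_path (f : R -> R) (s b0 T0 : R) (xi b : R -> R) :=
  forall T, 0 <= T <= T0 ->
    b T = b0 + \int[lebesgue_measure]_(r in `[0, T]) (b r + f (b r))
          + s * xi T.

(* Continuity of all the paths of b, rather than almost all, only serves to
   make functionals of the paths such as lyapunov below measurable. *)
Definition solution d (Om : measurableType d) (P : probability Om R)
    (f : R -> R) (s b0 T0 : R) (xi : R -> Om -> R) (b : R -> {RV P >-> R}) :=
  (forall w, {within `[0, T0], continuous (b ^~ w)}) /\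
  {ae P, forall w, solves_path f s b0 T0 (xi ^~ w) (b ^~ w)}.

Definition lyapunov (f : R -> R) (T : R) (b : R -> R) : R :=
  T^-1 * ln (expR (T + \int[lebesgue_measure]_(r in `[0, T]) derive1 f (b r))).

Definition bigO_eps (F f : R -> R) :=
  exists C ep0 : R, [/\ 0 < C, 0 < ep0 &
    forall ep, 0 < ep <= ep0 -> `|F ep| <= C * f ep].

End AmplitudeEquation.

(* Main.v *)
Require Import Defs.
From HB Require Import structures.
From mathcomp Require Import all_boot all_order all_algebra sesquilinear.
From mathcomp Require Import ring lra.
From mathcomp Require Import all_classical all_reals all_analysis.
From mathcomp Require Import measurable_realfun.

(* As [D F_c(b) = -3 c0 b^2], the exponent is at least 1/4 as soon as
   [4 c0 b^2 <= 1] on [0, T], and a Gronwall argument shows that this holds when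
   the initial condition and the supremum of the noise are small. It remains to
   see that the supremum of a centered Gaussian process beta with continuous
   paths is small with positive probability. Let beta' be an independent copy.
   By separability of the space of continuous paths, beta - beta' is uniformly
   small with positive probability, and (beta - beta') / sqrt 2 has the law of
   beta. Only the laws of the linear combinations of the beta t being known,
   this last fact is used in the form
     E cos (sum_i a_i beta_(t_i))
       = E cos (sum_i a_i (beta - beta')_(t_i) / sqrt 2),
   so that the two processes have the same expectations of trigonometric
   polynomials. The polynomials [prod_i (1 - u_i^k)^(2^k)] with
   [u_i = (1 - cos x_i) / 2] tend to 1 where every [cos x_i] is positive and to
   0 where one of them is negative, hence
     Pr (forall i, cos (theta_i (beta - beta')_(t_i) / sqrt 2) > 0)
       <= Pr (forall i, cos (theta_i beta_(t_i)) >= 0),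
   and letting the [theta_i] run over theta 2^-m turns the last event into
   [|theta beta_t| <= pi / 2] for all t. *)

Set Implicit Arguments.
Unset Strict Implicit.
Unset Printing Implicit Defensive.
Import Order.TTheory GRing.Theory Num.Theory.
Import numFieldNormedType.Exports.
Local Open Scope classical_set_scope.
Local Open Scope ring_scope.

(** * Normal laws and independent copies *)

Section normal_law.
Context {R : realType}.
Notation mu := (@lebesgue_measure R).
Notation r2 := (Num.sqrt 2 : R).

Lemma sqrt2_gt0 : 0 < r2. Proof. by rewrite sqrtr_gt0. Qed.

(* With x = sqrt 2 z + y, the two factors on the right are the density of the
   normalised difference z = (x - y) / sqrt 2 and, given z, that of y. *)
Lemma normal_pdf_shear (s y z : R) : 0 < s ->
  normal_pdf 0 s (r2 * z + y) * r2 * normal_pdf 0 s y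
  = normal_pdf 0 s z * normal_pdf (- (z / r2)) (s / r2) y.
Proof.
move=> s0; have r20 := sqrt2_gt0.
have r2E : r2 ^+ 2 = 2 by rewrite sqr_sqrtr.
rewrite !normal_pdfE ?gt_eqF ?divr_gt0// /normal_peak /normal_fun.
have -> : (Num.sqrt ((s / r2) ^+ 2 * pi *+ 2))^-1
    = r2 * (Num.sqrt (s ^+ 2 * pi *+ 2))^-1.
  rewrite -[X in _ = X * _](invrK r2) -invfM; congr (_^-1).
  rewrite [in RHS](_ : s ^+ 2 * pi *+ 2 = r2 ^+ 2 * ((s / r2) ^+ 2 * pi *+ 2)).
    by rewrite sqrtrM ?sqr_ge0// sqrtr_sqr gtr0_norm// mulKf// gt_eqF.
  by field; rewrite gt_eqF.
set c := (Num.sqrt _)^-1; set E1 := expR _; set E2 := expR _; set E3 := expR _;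
  set E4 := expR _.
suff H : E1 * E2 = E3 * E4.
  by transitivity (c * c * r2 * (E1 * E2)); [|rewrite H]; ring.
rewrite /E1 /E2 /E3 /E4 -!expRD; congr expR.
have -> : (s / r2) ^+ 2 *+ 2 = s ^+ 2.
  by rewrite exprMn exprVn r2E -mulr_natr divfK// pnatr_eq0.
have -> : z / r2 = r2 * z / 2.
  by rewrite -[X in _ = _ / X]r2E; field; rewrite gt_eqF.
have -> : s ^+ 2 *+ 2 = 2 * s ^+ 2 by rewrite mulr_natl.
apply: (@mulfI _ (2 * s ^+ 2)).
  by rewrite mulf_neq0// ?pnatr_eq0// expf_neq0// gt_eqF.
rewrite !mulrDr.
have s1 : s != 0 by rewrite gt_eqF.
transitivity (- (r2 ^+ 2 * z ^+ 2 + 2 * r2 * z * y + 2 * y ^+ 2)).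
  by field.
by rewrite r2E; field: r2E.
Qed.

Lemma derive1_affine (a b : R) : (fun x : R => a * x + b)^`()%classic = cst a.
Proof.
apply/funext => x; rewrite derive1E deriveD// derive_cst addr0.
by rewrite deriveM// derive_cst derive_id scaler0 addr0 /GRing.scale/= mulr1.
Qed.

Lemma integral_affine (a b : R) (G : R -> R) : 0 < a -> continuous G ->
  (forall x, 0 <= G x) ->
  (\int[mu]_x (G x)%:E = \int[mu]_x (G (a * x + b) * a)%:E)%E.
Proof.
move=> a0 cG G0.
rewrite (@increasing_ge0_integration_by_substitutionT _ (fun x => a * x + b))//.
- by apply: eq_integral => x _; rewrite derive1_affine.
- by move=> x y xy; rewrite ltrD2r ltr_pM2l.
- by rewrite derive1_affine => ?; exact: cvg_cst.
- by rewrite derive1_affine; exact: is_cvg_cst.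
- by rewrite derive1_affine; exact: is_cvg_cst.
- rewrite (_ : (fun x => _) = (fun x => x + b) \o (fun x => x * a)); last first.
    by apply/funext => x /=; rewrite mulrC.
  by apply: cvg_comp; [apply/gt0_cvgMlNy|exact: cvg_addrr_Ny].
- rewrite (_ : (fun x => _) = (fun x => x + b) \o (fun x => x * a)); last first.
    by apply/funext => x /=; rewrite mulrC.
  by apply: cvg_comp; [apply/gt0_cvgMly|exact: cvg_addrr].
Qed.

(** Adding 1 to the cosine makes the integrands nonnegative, so that Tonelli's theorem and changes
    of variables apply without integrability conditions. *)
Lemma continuous_1cos : continuous (fun x : R => 1 + cos x).
Proof. by move=> x; apply: cvgD; [exact: cvg_cst|exact: continuous_cos]. Qed.

Lemma onecos_ge0 (x : R) : 0 <= 1 + cos x.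
Proof. by rewrite addrC -lerBlDr sub0r cos_geN1. Qed.

(** The normal law is dominated by the Lebesgue measure, and its Radon-Nikodym derivative has the
    same integral as [normal_pdf] over every measurable set, hence equals it almost everywhere. *)
Lemma ge0_integral_normal_prob (m s : R) (f : R -> \bar R) :
  measurable_fun [set: R] f -> (forall x, (0 <= f x)%E) ->
  (\int[normal_prob m s]_x f x = \int[mu]_x (f x * (normal_pdf m s x)%:E))%E.
Proof.
move=> mf f0.
have dom := @normal_prob_dominates R m s.
rewrite -(Radon_Nikodym_SigmaFinite.change_of_variables dom)//.
have fi := Radon_Nikodym_SigmaFinite.f_integrable dom.
have mp : measurable_fun setT (fun x => (normal_pdf m s x)%:E).
  by apply/measurable_EFinP; exact: measurable_normal_pdf.
apply: ae_eq_integral => //.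
- by apply: emeasurable_funM => //; exact: measurable_int fi.
- exact: emeasurable_funM.
- apply: ae_eqe_mul2l => /=; apply: integral_ae_eq => //=.
  by move=> E _ mE; rewrite -Radon_Nikodym_SigmaFinite.f_integral.
Qed.

(** The substitution x = sqrt 2 z + y in the inner integral leaves 1 + cos z. After the integrals
    are exchanged, [normal_pdf_shear] makes y range over a normal density, of total mass 1. *)
Lemma normal_cos_stable (s : R) : 0 < s ->
  (\int[normal_prob 0 s]_y \int[normal_prob 0 s]_x (1 + cos ((x - y) / r2))%:E =
   \int[normal_prob 0 s]_z (1 + cos z)%:E)%E.
Proof.
move=> s0; have r20 := sqrt2_gt0.
have mK : measurable_fun setT (fun x : R => 1 + cos x).
  by apply: continuous_measurable_fun; exact: continuous_1cos.
have mp : measurable_fun setT (normal_pdf 0 s) by exact: measurable_normal_pdf.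
pose g (u : R * R) := (1 + cos u.2) *
  (normal_pdf 0 s (r2 * u.2 + u.1) * r2 * normal_pdf 0 s u.1).
have g0 u : 0 <= g u.
  rewrite mulr_ge0 ?onecos_ge0// mulr_ge0 ?normal_pdf_ge0//.
  by rewrite mulr_ge0 ?normal_pdf_ge0// ltW.
have mg : measurable_fun setT g.
  apply: measurable_funM; first exact: (measurableT_comp mK measurable_snd).
  apply: measurable_funM; last exact: (measurableT_comp mp measurable_fst).
  apply: measurable_funM => //; apply: (measurableT_comp mp).
  by apply: measurable_funD => //; exact: measurable_funM.
have inner y : (\int[normal_prob 0 s]_x (1 + cos ((x - y) / r2))%:E =
    \int[mu]_z ((1 + cos z) * (normal_pdf 0 s (r2 * z + y) * r2))%:E)%E.
  rewrite ge0_integral_normal_prob//.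
  - pose G x := (1 + cos ((x - y) / r2)) * normal_pdf 0 s x.
    transitivity (\int[mu]_x (G x)%:E)%E.
      by apply: eq_integral => x _; rewrite EFinM.
    rewrite (@integral_affine r2 y)//.
    + apply: eq_integral => x _; rewrite /G mulrA.
      have -> // : (r2 * x + y - y) / r2 = x.
      by rewrite addrK mulrAC mulfV ?mul1r// gt_eqF.
    + move=> x; apply: cvgM; last first.
        by apply: continuous_normal_pdf; rewrite gt_eqF.
      apply: (@continuous_comp _ _ _ (fun x => (x - y) / r2)
        (fun x => 1 + cos x)); last exact: continuous_1cos.
      apply: cvgM; last exact: cvg_cst.
      by apply: cvgB; [exact: cvg_id|exact: cvg_cst].
    + by move=> x; rewrite /G mulr_ge0 ?onecos_ge0// normal_pdf_ge0.
  - apply/measurable_EFinP; apply: (measurableT_comp mK).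
    by apply: measurable_funM => //; exact: measurable_funB.
transitivity (\int[mu]_y \int[mu]_z (g (y, z))%:E)%E.
  rewrite ge0_integral_normal_prob.
  - apply: eq_integral => y _; rewrite inner -ge0_integralZr//.
    + by apply: eq_integral => z _; rewrite -EFinM /g /= !mulrA.
    + apply/measurable_EFinP; apply: measurable_funM => //.
      apply: measurable_funM => //; apply: (measurableT_comp mp).
      by apply: measurable_funD => //; exact: measurable_funM.
    + move=> z _; rewrite lee_fin mulr_ge0 ?onecos_ge0//.
      by rewrite mulr_ge0 ?normal_pdf_ge0// ltW.
    + by rewrite lee_fin normal_pdf_ge0.
  - under [X in measurable_fun _ X]eq_fun do rewrite inner.
    pose h (u : R * R) :=
      (1 + cos u.2) * (normal_pdf 0 s (r2 * u.2 + u.1) * r2).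
    apply: (@measurable_fun_fubini_tonelli_F _ _ _ _ _ mu (EFin \o h)).
      apply/measurable_EFinP; apply: measurable_funM.
        exact: (measurableT_comp mK measurable_snd).
      apply: measurable_funM => //; apply: (measurableT_comp mp).
      by apply: measurable_funD => //; exact: measurable_funM.
    move=> u; rewrite lee_fin mulr_ge0 ?onecos_ge0//.
    by rewrite mulr_ge0 ?normal_pdf_ge0// ltW.
  - by move=> y; rewrite integral_ge0// => x _; rewrite lee_fin onecos_ge0.
rewrite (@fubini_tonelli _ _ _ _ _ mu mu (EFin \o g))//; last first.
  by apply/measurable_EFinP.
rewrite ge0_integral_normal_prob//; last exact/measurable_EFinP.
apply: eq_integral => z _ /=.
transitivity (\int[mu]_y (((1 + cos z) * normal_pdf 0 s z)%:E *
    (normal_pdf (- (z / r2)) (s / r2) y)%:E))%E.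
  by apply: eq_integral => y _; rewrite /g /= normal_pdf_shear// mulrA EFinM.
rewrite ge0_integralZl//.
- by rewrite integral_normal_pdf mule1 EFinM.
- by apply/measurable_EFinP; exact: measurable_normal_pdf.
- by move=> y _; rewrite lee_fin normal_pdf_ge0.
- by rewrite lee_fin mulr_ge0 ?onecos_ge0 ?normal_pdf_ge0.
Qed.

Lemma ge0_integralN (f : R -> \bar R) : measurable_fun [set: R] f ->
  (forall x, (0 <= f x)%E) -> (\int[mu]_x f x = \int[mu]_x (f \o -%R) x)%E.
Proof.
move=> mf f0.
rewrite (_ : (\int[mu]_x (f \o -%R) x)%E =
  (\int[mu]_(x in (-%R : _ -> measurableTypeR R) @^-1` setT) (f \o -%R) x)%E)//.
rewrite -ge0_integral_pushforward//=.
by apply: eq_measure_integral => //= A mA AS; exact/esym/lebesgue_measureN.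
Qed.

(** Reflection about [m] exchanges the two sides. This symmetry replaces a computation of the mean
    when [m] is shown to be 0. *)
Lemma normal_pos_neg (m s : R) : 0 < s ->
  (\int[normal_prob m s]_x (Num.max (x - m) 0)%:E =
   \int[normal_prob m s]_x (Num.max (m - x) 0)%:E)%E.
Proof.
move=> s0; have s1 : s != 0 by rewrite gt_eqF.
pose G x := Num.max (x - m) 0 * normal_pdf m s x.
pose K x := Num.max (m - x) 0 * normal_pdf m s x.
have G0 x : 0 <= G x by rewrite mulr_ge0 ?normal_pdf_ge0// le_max lexx orbT.
have K0 x : 0 <= K x by rewrite mulr_ge0 ?normal_pdf_ge0// le_max lexx orbT.
have cG : continuous G.
  move=> x; apply: cvgM; last exact: continuous_normal_pdf.
  apply: (@continuous_max _ _ (fun x => x - m) (cst 0)); last exact: cvg_cst.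
  by apply: cvgB; [exact: cvg_id|exact: cvg_cst].
have cK : continuous K.
  move=> x; apply: cvgM; last exact: continuous_normal_pdf.
  apply: (@continuous_max _ _ (fun x => m - x) (cst 0)); last exact: cvg_cst.
  by apply: cvgB; [exact: cvg_cst|exact: cvg_id].
have GK x : G (x + m) = K (- x + m).
  rewrite /G /K; congr (Num.max _ _ * _); first by ring.
  by rewrite !normal_pdfE// /normal_fun !addrK sqrrN.
have mx (b : bool) : measurable_fun [set: R]
    (fun x => (Num.max (if b then x - m else m - x) 0)%:E).
  apply/measurable_EFinP; apply: measurable_maxr => //.
  by case: b; apply: measurable_funB.
rewrite !ge0_integral_normal_prob//; last 4 first.
- exact: (mx false).
- by move=> x; rewrite lee_fin le_max lexx orbT.
- exact: (mx true).
- by move=> x; rewrite lee_fin le_max lexx orbT.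
transitivity (\int[mu]_x (G x)%:E)%E.
  by apply: eq_integral => x _; rewrite EFinM.
transitivity (\int[mu]_x (K x)%:E)%E; last first.
  by apply: eq_integral => x _; rewrite EFinM.
rewrite (integral_affine m ltr01 cG G0) (integral_affine m ltr01 cK K0).
rewrite ge0_integralN.
- by apply: eq_integral => x _; rewrite /= !mul1r !mulr1 GK opprK.
- apply/measurable_EFinP; apply: continuous_measurable_fun => x.
  apply: cvgM; last exact: cvg_cst.
  apply: (cvg_comp (fun x : R => 1 * x + m) G); last exact: cG.
  by apply: cvgD; [apply: cvgM; [exact: cvg_cst|exact: cvg_id]|exact: cvg_cst].
- by move=> x; rewrite lee_fin mulr1.
Qed.

End normal_law.

(** * Centered Gaussian variables and their independent copies *)

Section gaussian_variable.
Context {R : realType} {d : measure_display} {Om : measurableType d}.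
Variable P : probability Om R.
Notation r2 := (Num.sqrt 2 : R).

Lemma ge0_integral_law (L : Om -> R) (Q : probability (measurableTypeR R) R)
    (f : R -> \bar R) :
  measurable_fun setT L ->
  (forall B, measurable B -> P (L @^-1` B) = Q B) ->
  measurable_fun [set: R] f -> (forall x, (0 <= f x)%E) ->
  (\int[P]_w f (L w) = \int[Q]_x f x)%E.
Proof.
move=> mL lawL mf f0.
have mL' : measurable_fun setT (L : Om -> measurableTypeR R) := mL.
rewrite -(ge0_integral_pushforward mL' P (D := setT) (f := f))//.
by apply: eq_measure_integral => A mA _; exact: lawL.
Qed.

(** The integral is the difference of the integrals of the positive and negative parts, and it is
    infinite as soon as one of these is, even when both are. The value 0 thus forces both to be
    finite. *)
Lemma integral0_integrable (L : Om -> R) : measurable_fun setT L ->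
  (\int[P]_w (L w)%:E = 0)%E -> P.-integrable setT (EFin \o L).
Proof.
move=> mL L0.
have mE : measurable_fun setT (EFin \o L) by exact/measurable_EFinP.
apply/integrableP; split => //.
have : (\int[P]_x (EFin \o L) x = 0)%E by [].
rewrite integralE.
have -> : (\int[P]_x `|(EFin \o L) x| =
    \int[P]_x ((EFin \o L)^\+ x + (EFin \o L)^\- x))%E.
  by apply: eq_integral => x _; have /(congr1 (@^~ x)) := fune_abse (EFin \o L).
rewrite ge0_integralD//; last 2 first.
- exact: measurable_funepos.
- exact: measurable_funeneg.
have : (0 <= \int[P]_x (EFin \o L)^\+ x)%E by exact: integral_ge0.
have : (0 <= \int[P]_x (EFin \o L)^\- x)%E by exact: integral_ge0.
case: (\int[P]_x (EFin \o L)^\+ x)%E => [a| |];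
  case: (\int[P]_x (EFin \o L)^\- x)%E => [b| |] //= _ _ _.
by rewrite -EFinD ltry.
Qed.

(** Equality of the two one-sided deviations, which are finite, gives E (L - m) = 0, whereas E L = 0
    gives E (L - m) = - m. This identifies the mean, which [normally_distributed] leaves free. *)
Lemma centered_mean0 (L : Om -> R) (m : R) : measurable_fun setT L ->
  (\int[P]_w (L w)%:E = 0)%E ->
  (\int[P]_w (Num.max (L w - m) 0)%:E = \int[P]_w (Num.max (m - L w) 0)%:E)%E ->
  m = 0.
Proof.
move=> mL L0 Lm.
have iL := integral0_integrable mL L0.
have im : P.-integrable setT (EFin \o cst m).
  by apply: finite_measure_integrable_cst.
have iLm : P.-integrable setT (EFin \o (fun w => L w - m)).
  rewrite (_ : _ \o _ = (EFin \o L) \- (EFin \o cst m))%E //.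
  exact: integrableB.
have : (\int[P]_w (L w - m)%:E = - m%:E)%E.
  have Im : (\int[P]_w (cst m w)%:E = m%:E)%E.
    rewrite -[RHS]mule1 -(probability_setT P).
    exact: (integral_cst P measurableT m%:E).
  by rewrite (integralB_EFin _ iL im)// L0 Im sub0e.
rewrite integralE.
have Epos : (\int[P]_x (fun w => (L w - m)%:E)^\+ x =
    \int[P]_x (Num.max (L x - m) 0)%:E)%E.
  by apply: eq_integral => x _; rewrite funeposE EFin_max.
have -> : (\int[P]_x (fun w => (L w - m)%:E)^\- x =
    \int[P]_x (Num.max (L x - m) 0)%:E)%E.
  rewrite Lm; apply: eq_integral => x _.
  by rewrite funenegE -EFinN -EFin_max opprB.
have := integrable_pos_fin_num measurableT iLm; rewrite Epos.
move=> fin; rewrite subee// => /eqP; rewrite -EFinN eqe => /eqP.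
by move/esym/eqP; rewrite oppr_eq0 => /eqP.
Qed.

(** On [P \x P] the two coordinates carry independent copies of [L]; Tonelli's theorem separates
    them and the law is substituted in one variable at a time. *)
Lemma integral_indep_copies (L : Om -> R)
    (Q : probability (measurableTypeR R) R) (f : R -> R) :
  measurable_fun setT L ->
  (forall B, measurable B -> P (L @^-1` B) = Q B) ->
  measurable_fun [set: R] f -> (forall x, 0 <= f x) ->
  (\int[P \x P]_w (f ((L w.1 - L w.2) / r2))%:E =
   \int[Q]_y \int[Q]_x (f ((x - y) / r2))%:E)%E.
Proof.
move=> mL lawL mf f0; have E := ge0_integral_law mL lawL.
rewrite (@fubini_tonelli2 _ _ _ _ _ P P); last 2 first.
- apply/measurable_EFinP; apply: (measurableT_comp mf).
  apply: measurable_funM => //; apply: measurable_funB.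
    exact: (measurableT_comp mL measurable_fst).
  exact: (measurableT_comp mL measurable_snd).
- by move=> u; rewrite lee_fin.
rewrite /fubini_G /=.
under eq_integral => y _.
  rewrite (E (fun x => (f ((x - L y) / r2))%:E)); last 2 first.
  - apply/measurable_EFinP; apply: (measurableT_comp mf).
    by apply: measurable_funM => //; exact: measurable_funB.
  - by move=> x; rewrite lee_fin.
  over.
rewrite (E (fun y => (\int[Q]_x (f ((x - y) / r2))%:E)%E))//.
- apply: (@measurable_fun_fubini_tonelli_G _ _ _ _ _ Q
    (fun u : R * R => (f ((u.1 - u.2) / r2))%:E)).
    apply/measurable_EFinP; apply: (measurableT_comp mf).
    by apply: measurable_funM => //; apply: measurable_funB.
  by move=> u; rewrite lee_fin.
- by move=> y; rewrite integral_ge0// => x _; rewrite lee_fin.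
Qed.

(** Once the mean is known to be 0, both sides are 1 + cos 0 for a Dirac mass, and
    [normal_cos_stable] settles the laws with a density. *)
Lemma gaussian_cos_stable (L : Om -> R) : measurable_fun setT L ->
  normally_distributed P L -> (\int[P]_w (L w)%:E = 0)%E ->
  (\int[P \x P]_w (1 + cos ((L w.1 - L w.2) / r2))%:E =
   \int[P]_w (1 + cos (L w))%:E)%E.
Proof.
move=> mL nL L0.
have mK : measurable_fun [set: R] (fun x : R => 1 + cos x).
  by apply: continuous_measurable_fun; exact: continuous_1cos.
have mK' := mK.
move/measurable_EFinP in mK'.
have mmax (m : R) (b : bool) : measurable_fun [set: R]
    (fun x : R => (Num.max (if b then x - m else m - x) 0)%:E).
  apply/measurable_EFinP; apply: measurable_maxr => //.
  by case: b; apply: measurable_funB.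
have max0 (x : R) : (0 <= (Num.max x 0)%:E)%E.
  by rewrite lee_fin le_max lexx orbT.
case: nL => [[m lawL]|[m [s [s0 lawL]]]].
- pose Q : probability (measurableTypeR R) R := \d_(m : measurableTypeR R).
  have dE (f : R -> \bar R) : measurable_fun [set: R] f ->
      (\int[Q]_x f x = f m)%E.
    move=> mf; rewrite (@integral_dirac _ (measurableTypeR R))//.
    by rewrite diracE mem_setT mul1e.
  have E := ge0_integral_law (Q := Q) mL lawL.
  have m0 : m = 0.
    apply: (centered_mean0 mL L0).
    rewrite (E _ (mmax m true))// (E _ (mmax m false))//.
    by rewrite (dE _ (mmax m true)) (dE _ (mmax m false)) /= subrr.
  rewrite (E (fun x => (1 + cos x)%:E))//.
  rewrite (integral_indep_copies (Q := Q) (f := fun x => 1 + cos x))//.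
  have mKc (y : R) : measurable_fun [set: R]
      (fun x : R => (1 + cos ((x - y) / r2))%:E).
    apply/measurable_EFinP; apply: (measurableT_comp mK).
    by apply: measurable_funM => //; exact: measurable_funB.
  rewrite (dE _ mK').
  under eq_integral => y _ do rewrite (dE _ (mKc y)).
  rewrite dE /= ?subrr ?mul0r ?m0//.
  apply/measurable_EFinP; apply: (measurableT_comp mK).
  by apply: measurable_funM => //; exact: measurable_funB.
- have E := ge0_integral_law (Q := normal_prob m s) mL lawL.
  have m0 : m = 0.
    apply: (centered_mean0 mL L0).
    by rewrite (E _ (mmax m true))// (E _ (mmax m false))// normal_pos_neg.
  subst m.
  rewrite (E (fun x => (1 + cos x)%:E))//.
  rewrite (integral_indep_copies (Q := normal_prob 0 s)
    (f := fun x => 1 + cos x))//.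
  exact: normal_cos_stable.
Qed.

End gaussian_variable.

(** * Comparison of boxes by trigonometric polynomials *)

Section countable_conditions.
Context {R : realType} {d : measure_display} {T : measurableType d}
  {J : countType}.
Variable W : J -> T -> R.
Hypothesis mW : forall k, measurable_fun setT (W k).

Lemma measurable_forall_itv (V : J -> T -> R) (i : interval R) :
  (forall k, measurable_fun setT (V k)) ->
  measurable [set w | forall k, V k w \in i].
Proof.
move=> mV; rewrite (_ : [set w | _] = \bigcap_n
  (if unpickle n is Some k then V k @^-1` [set` i] else setT)).
  apply: bigcap_measurable => // n _; case: unpickle => // k.
  by rewrite -[X in measurable X]setTI; exact: mV.
apply/seteqP; split => w /= h; first by move=> n _; case: unpickle => // k.
by move=> k; have := h (pickle k) I; rewrite pickleK.
Qed.

Lemma measurable_forall_norm_le (c : R) :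
  measurable [set w | forall k, `|W k w| <= c].
Proof.
rewrite (_ : [set w | _] = [set w | forall k, W k w \in `[- c, c]]).
  exact: measurable_forall_itv.
by apply/seteqP; split => w h k; have := h k; rewrite in_itv/= ler_norml.
Qed.

Let mcos k : measurable_fun setT (fun w => cos (W k w)).
Proof.
apply: (@measurableT_comp _ _ _ _ _ _ (@cos R)) => //.
by apply: continuous_measurable_fun; exact: continuous_cos.
Qed.

Lemma measurable_forall_cos_ge0 :
  measurable [set w | forall k, 0 <= cos (W k w)].
Proof.
rewrite (_ : [set w | _] = [set w | forall k, cos (W k w) \in `[0, +oo[]).
  exact: (measurable_forall_itv _ mcos).
by apply/seteqP; split => w h k; have := h k; rewrite in_itv/= andbT.
Qed.

Lemma measurable_forall_cos_gt0 :
  measurable [set w | forall k, 0 < cos (W k w)].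
Proof.
rewrite (_ : [set w | _] = [set w | forall k, cos (W k w) \in `]0, +oo[]).
  exact: (measurable_forall_itv _ mcos).
by apply/seteqP; split => w h k; have := h k; rewrite in_itv/= andbT.
Qed.

End countable_conditions.

(** * Polynomials approximating a step at 1/2 *)

Section cutoff.
Context {R : realType}.
Implicit Types u v y : R.

(** The two exponents are balanced: for u >= 0, the product of 2^k and u^k is (2u)^k, which tends to
    0 or to infinity according to the side of 1/2 on which u lies. *)
Definition cutoff (k : nat) u : R := (1 - u ^+ k) ^+ (2 ^ k).

Lemma half1Bcos_ge0 y : 0 <= (1 - cos y) / 2.
Proof. by have := cos_le1 y; lra. Qed.

Lemma half1Bcos_le1 y : (1 - cos y) / 2 <= 1.
Proof. by have := cos_geN1 y; lra. Qed.

Lemma cutoff_ge0 k u : 0 <= u <= 1 -> 0 <= cutoff k u.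
Proof.
by move=> /andP[u0 u1]; rewrite exprn_ge0// subr_ge0 exprn_ile1.
Qed.

Lemma cutoff_le1 k u : 0 <= u <= 1 -> cutoff k u <= 1.
Proof.
move=> /andP[u0 u1]; rewrite exprn_ile1//; first by rewrite subr_ge0 exprn_ile1.
by rewrite lerBlDr lerDl exprn_ge0.
Qed.

Lemma bernoulli_le N v : -1 <= v -> 1 + N%:R * v <= (1 + v) ^+ N.
Proof.
move=> v1; elim: N => [|N IH]; first by rewrite mul0r addr0 expr0.
rewrite exprS (le_trans _ (ler_wpM2l _ IH))//; last by lra.
rewrite -subr_ge0 -natr1 (_ : _ - _ = N%:R * v ^+ 2); last by ring.
by rewrite mulr_ge0// sqr_ge0.
Qed.

(** Bernoulli's inequality bounds the cutoff below by 1 - (2u)^k. *)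
Lemma cvg_cutoff1 u : 0 <= u < 2^-1 -> cutoff k u @[k --> \oo] --> (1 : R).
Proof.
move=> /andP[u0 u2].
have u01 : 0 <= u <= 1 by apply/andP; split => //; lra.
apply: (@squeeze_cvgr _ _ _ _ (fun k => 1 - (2 * u) ^+ k) (cst 1)).
- near=> k; rewrite cutoff_le1// andbT.
  rewrite /cutoff exprMn -natrX -mulrN; apply: bernoulli_le.
  by rewrite lerN2 exprn_ile1//; lra.
- rewrite -[X in _ --> X]subr0; apply: cvgB; first exact: cvg_cst.
  by apply: cvg_expr; rewrite ger0_norm; lra.
- exact: cvg_cst.
Unshelve. all: by end_near. Qed.

(** With v = u^k, (1 - v)(1 + v) <= 1 bounds the cutoff by the inverse of (1 + v)^(2^k), and
    Bernoulli's inequality bounds this power below by (2u)^k. *)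
Lemma cvg_cutoff0 u : 2^-1 < u <= 1 -> cutoff k u @[k --> \oo] --> (0 : R).
Proof.
move=> /andP[u2 u1].
have u01 : 0 <= u <= 1 by apply/andP; split => //; lra.
apply: (@squeeze_cvgr _ _ _ _ (cst 0) (fun k => ((2 * u)^-1) ^+ k)).
- near=> k; rewrite cutoff_ge0//=.
  have u0 : 0 < (2 * u) ^+ k by rewrite exprn_gt0//; lra.
  rewrite exprVn -[leRHS]mul1r ler_pdivlMr//.
  have v0 : 0 <= u ^+ k <= 1 by rewrite exprn_ge0 ?exprn_ile1//; lra.
  rewrite (@le_trans _ _ (cutoff k u * (1 + u ^+ k) ^+ (2 ^ k)))//.
    rewrite ler_wpM2l ?cutoff_ge0//.
    rewrite (le_trans _ (bernoulli_le _ _))//; last by lra.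
    by rewrite exprMn -natrX lerDr.
  rewrite /cutoff -exprMn exprn_ile1//; first by rewrite mulr_ge0//; lra.
  rewrite -subr_ge0 (_ : _ - _ = (u ^+ k) ^+ 2); last by ring.
  exact: sqr_ge0.
- exact: cvg_cst.
- by apply: cvg_expr; rewrite ger0_norm ?invr_ge0; [rewrite invf_lt1|]; lra.
Unshelve. all: by end_near. Qed.

End cutoff.

(** * The algebra of trigonometric polynomials *)

Section trigonometric_polynomials.
Context {R : realType} {n : nat}.

(** The linear span of the cosines of linear forms, to which an equality of expectations of cosines
    extends by linearity. *)
Inductive trigpoly : (('I_n -> R) -> R) -> Prop :=
| trigpoly_cos (a : 'I_n -> R) : trigpoly (fun x => cos (\sum_i a i * x i))
| trigpoly_lin (c : R) f g : trigpoly f -> trigpoly g ->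
    trigpoly (fun x => c * f x + g x).

Lemma trigpoly_cst (c : R) : trigpoly (fun=> c).
Proof.
have T1 : trigpoly (fun=> 1).
  have := trigpoly_cos (fun=> 0); congr trigpoly; apply/funext => x.
  by rewrite big1 ?cos0// => i _; rewrite mul0r.
have := trigpoly_lin (c - 1) T1 T1; congr trigpoly.
by apply/funext => x; ring.
Qed.

(** A double induction reduces the claim to cos a cos b = (cos (a + b) + cos (a - b)) / 2. *)
Lemma trigpolyM f g : trigpoly f -> trigpoly g -> trigpoly (fun x => f x * g x).
Proof.
move=> tf tg; elim: tf => [a|c f1 f2 _ tf1 _ tf2]; last first.
  have := trigpoly_lin c tf1 tf2; congr trigpoly.
  by apply/funext => x; ring.
elim: tg => [b|c g1 g2 _ tg1 _ tg2]; last first.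
  have := trigpoly_lin c tg1 tg2; congr trigpoly.
  by apply/funext => x; ring.
have := trigpoly_lin 2^-1 (trigpoly_cos (fun i => a i + b i))
  (trigpoly_lin 2^-1 (trigpoly_cos (fun i => a i - b i)) (trigpoly_cst 0)).
congr trigpoly; apply/funext => x.
have -> : \sum_i (a i + b i) * x i = \sum_i a i * x i + \sum_i b i * x i.
  by rewrite -big_split; apply: eq_bigr => i _; rewrite mulrDl.
have -> : \sum_i (a i - b i) * x i = \sum_i a i * x i - \sum_i b i * x i.
  by rewrite -sumrB; apply: eq_bigr => i _; rewrite mulrBl.
by rewrite cosD cosB; field.
Qed.

Lemma trigpolyX f k : trigpoly f -> trigpoly (fun x => f x ^+ k).
Proof.
move=> tf; elim: k => [|k IH]; first exact: (trigpoly_cst 1).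
by have := trigpolyM tf IH; congr trigpoly; apply/funext => x; rewrite exprS.
Qed.

Lemma trigpoly_prod (I : Type) (r : seq I) (f : I -> ('I_n -> R) -> R) :
  (forall i, trigpoly (f i)) -> trigpoly (fun x => \prod_(i <- r) f i x).
Proof.
move=> tf; elim: r => [|i r IH].
  have := trigpoly_cst 1; congr trigpoly.
  by apply/funext => x; rewrite big_nil.
have := trigpolyM (tf i) IH; congr trigpoly.
by apply/funext => x; rewrite big_cons.
Qed.

(** The map from x_i to (1 - cos x_i) / 2 takes values in [0, 1] and sends the condition cos x_i = 0
    to the threshold 1/2 of [cutoff]. *)
Definition box_cutoff (k : nat) (x : 'I_n -> R) : R :=
  \prod_(i < n) cutoff k ((1 - cos (x i)) / 2).

Lemma trigpoly_box_cutoff k : trigpoly (box_cutoff k).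
Proof.
apply: trigpoly_prod => i; apply: trigpolyX.
have tc : trigpoly (fun x => (1 - cos (x i)) / 2).
  have := trigpoly_lin (- 2^-1) (trigpoly_cos (fun j => (j == i)%:R))
    (trigpoly_cst 2^-1).
  congr trigpoly; apply/funext => x.
  have -> : \sum_j (j == i)%:R * x j = x i.
    rewrite (bigD1 i)//= eqxx mul1r big1 ?addr0// => j /negbTE ->.
    by rewrite mul0r.
  by field.
have := trigpoly_lin (-1) (trigpolyX k tc) (trigpoly_cst 1).
by congr trigpoly; apply/funext => x; ring.
Qed.

Lemma box_cutoff_ge0 k x : 0 <= box_cutoff k x.
Proof.
by apply: prodr_ge0 => i _; rewrite cutoff_ge0// half1Bcos_ge0 half1Bcos_le1.
Qed.

Lemma box_cutoff_le1 k x : box_cutoff k x <= 1.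
Proof.
rewrite /box_cutoff; apply: Num.Theory.prodr_ile1 => i _.
by rewrite cutoff_ge0 ?cutoff_le1// half1Bcos_ge0 half1Bcos_le1.
Qed.

Lemma cvg_box_cutoff1 x : (forall i, 0 < cos (x i)) ->
  box_cutoff k x @[k --> \oo] --> (1 : R).
Proof.
move=> x0; rewrite /box_cutoff.
rewrite [X in _ --> X](_ : _ = \prod_(i < n) (1 : R)); last by rewrite big1.
apply: cvg_big => [|i _]; first exact: mul_continuous.
apply: cvg_cutoff1.
by rewrite half1Bcos_ge0/=; have := x0 i; lra.
Qed.

Lemma cvg_box_cutoff0 x i : cos (x i) < 0 ->
  box_cutoff k x @[k --> \oo] --> (0 : R).
Proof.
move=> x0.
apply: (@squeeze_cvgr _ _ _ _ (cst 0)
  (fun k => cutoff k ((1 - cos (x i)) / 2))).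
- near=> k; rewrite box_cutoff_ge0/= /box_cutoff (bigD1 i)//= ler_piMr//.
    by rewrite cutoff_ge0// half1Bcos_ge0 half1Bcos_le1.
  apply: Num.Theory.prodr_ile1 => j _.
  by rewrite cutoff_ge0 ?cutoff_le1// half1Bcos_ge0 half1Bcos_le1.
- exact: cvg_cst.
- by apply: cvg_cutoff0; rewrite half1Bcos_le1 andbT; lra.
Unshelve. all: by end_near. Qed.

Section integral.
Context {d : measure_display} {Om : measurableType d}.
Variables (P : probability Om R) (U : 'I_n -> Om -> R).
Hypothesis mU : forall i, measurable_fun setT (U i).

Lemma measurable_trigpoly f : trigpoly f ->
  measurable_fun setT (fun w => f (U ^~ w)).
Proof.
elim=> [a|c f1 f2 _ m1 _ m2]; last first.
  by apply: measurable_funD => //; exact: measurable_funM.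
apply: (@measurableT_comp _ _ _ _ _ _ (@cos R)).
  by apply: continuous_measurable_fun; exact: continuous_cos.
by apply: measurable_sum => i; exact: measurable_funM.
Qed.

Lemma integrable_trigpoly f : trigpoly f ->
  P.-integrable setT (fun w => (f (U ^~ w))%:E).
Proof.
move=> tf; elim: (tf) => [a|c f1 f2 _ i1 _ i2]; last first.
  have := integrableD measurableT (integrableZl measurableT c i1) i2.
  by apply: eq_integrable => // w _; rewrite EFinD EFinM.
apply: (@le_integrable _ _ _ P setT measurableT _ (EFin \o cst 1)) => //.
- by apply/measurable_EFinP; exact: (measurable_trigpoly (trigpoly_cos a)).
- by move=> w _ /=; rewrite normr1 lee_fin ler_norml cos_geN1 cos_le1.
- exact: finite_measure_integrable_cst.
Qed.

End integral.

End trigonometric_polynomials.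

(** * Comparison of two families with the same cosine expectations *)

Section box_comparison.
Context {R : realType} {n : nat} {d d' : measure_display}
  {Om : measurableType d} {Om' : measurableType d'}.
Variables (P : probability Om R) (Q : probability Om' R).
Variables (U : 'I_n -> Om -> R) (V : 'I_n -> Om' -> R).
Hypothesis mU : forall i, measurable_fun setT (U i).
Hypothesis mV : forall i, measurable_fun setT (V i).
Hypothesis cosE : forall a : 'I_n -> R,
  (\int[P]_w (1 + cos (\sum_i a i * U i w))%:E =
   \int[Q]_w (1 + cos (\sum_i a i * V i w))%:E)%E.

(** All expectations being finite, the summand 1 of [cosE] cancels; the rest is linearity. *)
Lemma integral_trigpolyE f : trigpoly f ->
  (\int[P]_w (f (U ^~ w))%:E = \int[Q]_w (f (V ^~ w))%:E)%E.
Proof.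
move=> tf; elim: (tf) => [a|c f1 f2 t1 e1 t2 e2]; last first.
  under eq_integral do rewrite EFinD EFinM.
  under [RHS]eq_integral do rewrite EFinD EFinM.
  rewrite !integralD//; last 4 first.
  - by apply: integrableZl => //; exact: integrable_trigpoly.
  - exact: integrable_trigpoly.
  - by apply: integrableZl => //; exact: integrable_trigpoly.
  - exact: integrable_trigpoly.
  by rewrite !integralZl ?e1 ?e2//; exact: integrable_trigpoly.
have := cosE a.
under eq_integral do rewrite EFinD.
under [RHS]eq_integral do rewrite EFinD.
rewrite !integralD//; last 4 first.
- exact: (integrable_trigpoly Q mV (trigpoly_cst 1)).
- exact: (integrable_trigpoly Q mV (trigpoly_cos a)).
- exact: (integrable_trigpoly P mU (trigpoly_cst 1)).
- exact: (integrable_trigpoly P mU (trigpoly_cos a)).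
have one d0 (T : measurableType d0) (M : probability T R) :
    (\int[M]_w 1%:E = 1)%E.
  rewrite -[RHS]mule1 -[X in (_ * X)%E](probability_setT M).
  exact: (integral_cst M measurableT).
have fU := integrable_fin_num measurableT
  (integrable_trigpoly P mU (trigpoly_cos a)).
have fV := integrable_fin_num measurableT
  (integrable_trigpoly Q mV (trigpoly_cos a)).
by rewrite !one -(fineK fU) -(fineK fV) -!EFinD => -[] /addrI ->.
Qed.

(** For each k, the integral of [g k] over [O] is at most that of [g k] over the whole space, which
    equals that of [h k], itself at most [P C] plus the integral of [h k] off [C]. By dominated
    convergence the two ends tend to [Q O] and [P C]. No limit is claimed where a cosine vanishes,
    hence one strict and one weak inequality. *)
Lemma box_comparison :
  (Q [set w | forall i, (0 < cos (V i w))%R] <=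
   P [set w | forall i, (0 <= cos (U i w))%R])%E.
Proof.
set O := [set w | _]; set C := [set w | forall i, _].
have mO : measurable O by exact: measurable_forall_cos_gt0.
have mC : measurable C by exact: measurable_forall_cos_ge0.
pose g k w := (box_cutoff k (V ^~ w))%:E.
pose h k w := (box_cutoff k (U ^~ w))%:E.
have mg k D : measurable D -> measurable_fun D (g k).
  move=> mD; apply/measurable_funTS/measurable_EFinP.
  exact: (measurable_trigpoly mV (trigpoly_box_cutoff k)).
have mh k D : measurable D -> measurable_fun D (h k).
  move=> mD; apply/measurable_funTS/measurable_EFinP.
  exact: (measurable_trigpoly mU (trigpoly_box_cutoff k)).
have g0 k w : (0 <= g k w)%E by rewrite lee_fin box_cutoff_ge0.
have h0 k w : (0 <= h k w)%E by rewrite lee_fin box_cutoff_ge0.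
have g1 k w : (g k w <= 1)%E by rewrite lee_fin box_cutoff_le1.
have h1 k w : (h k w <= 1)%E by rewrite lee_fin box_cutoff_le1.
have cvgO : (\int[Q]_(w in O) g k w)%E @[k --> \oo] --> Q O.
  have -> : Q O = (\int[Q]_(w in O) 1)%E by rewrite integral_cst// mul1e.
  apply: (@dominated_cvg _ _ _ Q O mO g (cst 1%E) (cst 1%E)) => //.
  - by move=> k; apply: mg.
  - move=> w Ow; apply: cvg_EFin; first exact: nearW.
    exact: cvg_box_cutoff1.
  - exact: finite_measure_integrable_cst.
  - by move=> k w _; rewrite gee0_abs.
have cvgC : (\int[P]_(w in ~` C) h k w)%E @[k --> \oo] --> 0%E.
  have -> : 0%E = (\int[P]_(w in ~` C) 0)%E by rewrite integral0.
  apply: (@dominated_cvg _ _ _ P (~` C) _ h (cst 0%E) (cst 1%E)) => //.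
  - exact: measurableC.
  - by move=> k; apply: mh; exact: measurableC.
  - move=> w Cw; apply: cvg_EFin; first exact: nearW.
    have /existsNP[i /negP] : ~ (forall i, 0 <= cos (U i w)) by [].
    by rewrite -ltNge; exact: cvg_box_cutoff0.
  - by apply: finite_measure_integrable_cst; exact: measurableC.
  - by move=> k w _; rewrite gee0_abs.
have cvgR : (P C + \int[P]_(w in ~` C) h k w)%E @[k --> \oo] --> P C.
  rewrite -[X in _ --> X]adde0; apply: cvgeD => //; last exact: cvg_cst.
  by rewrite fin_num_adde_defl.
apply: (lee_cvg_to cvgO cvgR); apply: nearW => k.
apply: (@le_trans _ _ (\int[Q]_w g k w)%E).
  by apply: ge0_subset_integral => //; exact: mg.
rewrite -[leLHS](integral_trigpolyE (trigpoly_box_cutoff k)) -/(h k).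
rewrite -(setUv C) (ge0_integral_setU _ mC (measurableC mC))//=; last 3 first.
- by apply: mh; rewrite setUv.
- by move=> w _; exact: h0.
- exact/disj_setPCl.
apply: leeD => //.
apply: (@le_trans _ _ (\int[P]_(w in C) (cst 1 w))%E).
  apply: ge0_le_integral => //;
    [by move=> w _; exact: h0|exact: mh|by move=> w _; exact: h1].
by rewrite integral_cst// mul1e.
Qed.

End box_comparison.

(** * Small balls of Gaussian processes *)

Section continuity.
Context {R : realType}.

Lemma continuous_within_dist (A : set R) (f : R -> R) (x e : R) :
  {within A, continuous f} -> A x -> 0 < e ->
  exists2 r : R, 0 < r & forall s, A s -> `|s - x| < r -> `|f s - f x| < e.
Proof.
move=> /subspace_continuousP cf Ax e0.
have /cvgr_dist_lt/(_ _ e0) := cf x Ax.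
rewrite near_withinE => /nbhs_ballP[r /= r0 rP]; exists r => // s As sx.
by rewrite distrC; apply: rP => //; rewrite /ball/= distrC.
Qed.

Lemma uniform_modulus (K e : R) (f : R -> R) :
  {within `[0, +oo[, continuous f} -> 0 < e ->
  exists N : nat, forall s t, 0 <= s <= K -> 0 <= t <= K ->
    `|s - t| <= N.+1%:R^-1 -> `|f s - f t| < e.
Proof.
move=> cf e0.
have /compact_near_coveringP cK := @segment_compact R 0 K.
(* The equation [t = x] attaches the property to a point, as the covering form of compactness
   requires. *)
pose Pn (N : nat) (x : R) := forall s t, 0 <= s <= K -> 0 <= t <= K -> t = x ->
    `|s - t| <= N.+1%:R^-1 -> `|f s - f t| < e.
have : \forall N \near \oo, `[0, K] `<=` Pn N.
  apply: cK => x /=; rewrite in_itv/= => /andP[x0 xK].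
  have e2 : 0 < e / 2 by rewrite divr_gt0.
  have Ax : `[0, +oo[%classic x by rewrite /= in_itv/= x0.
  have [r r0 rP] := continuous_within_dist cf Ax e2.
  have {}rP s : 0 <= s -> `|s - x| < r -> `|f s - f x| < e / 2.
    by move=> s0; apply: rP => //=; rewrite in_itv/= s0.
  have r20 : 0 < r / 2 by lra.
  near=> y N => s t /andP[s0 sK] /andP[t0 tK] /= ty sy; subst t.
  have yx : `|x - y| < r / 2 by near: y; apply: nbhsx_ballx; lra.
  have Nr : N.+1%:R^-1 < r / 2.
    by near: N; exact: (near_infty_natSinv_lt (PosNum r20)).
  have t_x : `|y - x| < r by rewrite distrC; lra.
  have s_x : `|s - x| < r.
    rewrite -(subrK y s) -addrA (le_lt_trans (ler_normD _ _))//.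
    by have := le_lt_trans sy Nr; rewrite distrC in yx; lra.
  rewrite -(subrK (f x) (f s)) -addrA (le_lt_trans (ler_normD _ _))//.
  by have := rP _ s0 s_x; have := rP _ t0 t_x; rewrite (distrC (f x)); lra.
move=> [N _ NP]; exists N => s t s0K t0K st.
by apply: (NP N (leqnn N) t) => //=; rewrite in_itv.
Unshelve. all: by end_near. Qed.
End continuity.

(** * From signs of cosines to small values *)

Section small_ball.
Context {R : realType}.

Lemma cos_lt0_pihalf_pi (x : R) : pi / 2 < x <= pi -> cos x < 0.
Proof.
move=> /andP[x1 x2]; rewrite -oppr_gt0 -sinBpihalf; apply: sin_gt0_pi.
by have := @pi_gt0 R; lra.
Qed.

(* If |y| > pi / 2, the first halving of |y| which is at most pi lies in
   ]pi / 2, pi], where cos is negative. *)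
Lemma norm_le_pihalf (y : R) : (forall m, 0 <= cos (2 ^- m * y)) ->
  `|y| <= pi / 2.
Proof.
move=> cy; rewrite leNgt; apply/negP => ypi; have pi0 := @pi_gt0 R.
have cosn m : cos (2 ^- m * y) = cos (`|y| / 2 ^+ m).
  by rewrite -cos_norm normrM mulrC normfV normrX normr_nat.
have ex : exists m, `|y| <= pi * 2 ^+ m.
  have [m ym] : exists m : nat, `|y| < m%:R * pi.
    exists (Num.trunc (`|y| / pi)).+1; rewrite -ltr_pdivrMr//.
    by rewrite truncnS_gt.
  exists m; rewrite (le_trans (ltW ym))// mulrC ler_pM2l// -natrX ler_nat.
  exact/ltnW/ltn_expl.
pose m := ex_minn ex.
have : cos (`|y| / 2 ^+ m) < 0.
  apply: cos_lt0_pihalf_pi; rewrite /m; case: ex_minnP => {m} m ym mmin.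
  have m0 : 0 < 2 ^+ m :> R by rewrite exprn_gt0.
  rewrite ler_pdivrMr// ym andbT ltr_pdivlMr//.
  case: m ym mmin m0 => [|m] _ mmin _; first by rewrite expr0 mulr1.
  rewrite ltNge exprS mulrA divfK//; apply/negP => /mmin.
  by rewrite ltnn.
by rewrite ltNge -cosn cy.
Qed.

Context {d : measure_display} {Om : measurableType d}.
Variable P : probability Om R.
Notation r2 := (Num.sqrt 2 : R).

(** [box_comparison] applies to the first n variables; the events [C n] decrease to the one on the
    right, and continuity from above passes to the limit. *)
Lemma gaussian_copies_le (X : nat -> Om -> R) :
  (forall k, measurable_fun setT (X k)) ->
  (forall n (a : 'I_n -> R),
    normally_distributed P (fun w => \sum_(i < n) a i * X i w) /\
    (\int[P]_w (\sum_(i < n) a i * X i w)%:E = 0)%E) ->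
  ((P \x P) [set w | forall k, `|X k w.1 - X k w.2| <= 1]%R <=
   P [set w | forall k, (0 <= cos (X k w))%R])%E.
Proof.
move=> mX gX.
pose V n (i : 'I_n) (w : Om * Om) := (X i w.1 - X i w.2) / r2.
pose C n := [set w | forall i : 'I_n, 0 <= cos (X i w)].
have mV n i : measurable_fun setT (@V n i).
  apply: measurable_funM => //; apply: measurable_funB.
    exact: (measurableT_comp (mX i) measurable_fst).
  exact: (measurableT_comp (mX i) measurable_snd).
have mC n : measurable (C n).
  exact: (measurable_forall_cos_ge0 (W := fun i : 'I_n => X i)).
have step n : ((P \x P) [set w | forall k, `|X k w.1 - X k w.2| <= 1]%R
    <= P (C n))%E.
  apply: le_trans (@box_comparison _ n _ _ _ _ P (P \x P)%E
    (fun i => X i) (@V n) _ _ _) => //.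
  - apply: le_measure; rewrite ?inE.
    + apply: (measurable_forall_norm_le (W := fun k w => X k w.1 - X k w.2)).
      move=> k; apply: measurable_funB.
        exact: (measurableT_comp (mX k) measurable_fst).
      exact: (measurableT_comp (mX k) measurable_snd).
    + exact: measurable_forall_cos_gt0.
    (* A difference of size at most 1, divided by sqrt 2, is below 1 <= pi / 2, where the cosine is
       positive. *)
    + move=> w /= h i; apply: cos_gt0_pihalf; rewrite -ltr_norml /V normrM.
      have r20 := @sqrt2_gt0 R; rewrite normfV (gtr0_norm r20) ltr_pdivrMr//.
      have r21 : 1 < r2 by rewrite -[ltLHS]sqrtr1 ltr_sqrt ?ltr1n.
      have p2 := @pi_ge2 R; rewrite (le_lt_trans (h i))// (lt_le_trans r21)//.
      by apply: ler_peMl; [exact: ltW|lra].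
  - move=> a; have [na a0] := gX n a.
    have mL : measurable_fun setT (fun w => \sum_(i < n) a i * X i w).
      by apply: measurable_sum => i; exact: measurable_funM.
    rewrite -(gaussian_cos_stable mL na a0); apply: eq_integral => w _.
    congr (1 + cos _)%:E; rewrite -sumrB mulr_suml; apply: eq_bigr => i _.
    by rewrite /V; ring.
have -> : [set w | forall k, (0 <= cos (X k w))%R] = \bigcap_n C n.
  apply/seteqP; split => w /=; first by move=> h n _ i; exact: h.
  by move=> h k; exact: (h k.+1 I ord_max).
have cvgC : P (C n) @[n --> \oo] --> P (\bigcap_n C n).
  apply: nonincreasing_cvg_mu => //.
  - by rewrite (le_lt_trans (probability_le1 P _))// ltry.
  - exact: bigcap_measurable.
  - by move=> m n mn; apply/subsetPset => w /= h i; exact: (h (widen_ord mn i)).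
by apply: (lee_cvg_to _ cvgC); [exact: cvg_cst|exact: nearW].
Qed.

End small_ball.

(** * Gaussian processes with continuous paths *)

Section continuous_gaussian.
Context {R : realType} {d : measure_display} {Om : measurableType d}.
Variables (P : probability Om R) (beta : R -> {RV P >-> R}).

Lemma trunc_grid (t : R) (N : nat) : 0 <= t ->
  let s := (Num.trunc (t * N.+1%:R))%:R / N.+1%:R in
  0 <= s <= t /\ `|t - s| <= N.+1%:R^-1.
Proof.
move=> t0 s; have N0 : 0 < N.+1%:R :> R by rewrite ltr0n.
have /truncn_itv/andP[l1 l2] : 0 <= t * N.+1%:R by rewrite mulr_ge0// ltW.
have st : s <= t by rewrite /s ler_pdivrMr.
split; first by rewrite st andbT /s divr_ge0// ltW.
rewrite ger0_norm ?subr_ge0// /s lerBlDr.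
rewrite -[X in X + _]mul1r -mulrDl ler_pdivlMr// (le_trans (ltW l2))//.
by rewrite -natr1 addrC.
Qed.

(** Separability made explicit: at the times [tau k], every continuous path is within e / 2 of one
    of countably many step functions. Were all the corresponding events negligible, the whole space
    would be. *)
Lemma continuous_ball_gt0 (tau : nat -> R) (K e : R) :
  (forall k, 0 <= tau k <= K) -> 0 < e ->
  {ae P, forall w, {within `[0, +oo[, continuous (beta ^~ w)}} ->
  exists A : set Om, [/\ measurable A, (0 < P A)%E &
    forall w w' k, A w -> A w' -> `|beta (tau k) w - beta (tau k) w'| <= e].
Proof.
move=> tauK e0 cb; pose e4 := e / 4; have e40 : 0 < e4 by rewrite divr_gt0.
(* The step function coded by [i] has mesh 1 / (i.1 + 1) and its successive heights are the integers
   of [i.2] in units of e / 4. *)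
pose x (i : nat * seq int) (t : R) : R :=
  e4 * (nth 0 i.2 (Num.trunc (t * i.1.+1%:R)))%:~R.
pose A i := [set w | forall k, `|beta (tau k) w - x i (tau k)| <= 2 * e4].
have mA i : measurable (A i).
  apply: (measurable_forall_norm_le
    (W := fun k w => beta (tau k) w - x i (tau k))) => k.
  exact: measurable_funB.
have [[i Ai]|noA] := pselect (exists i, (0 < P (A i))%E).
  exists (A i); split => // w w' k Aw Aw'.
  have := Aw k; have := Aw' k; rewrite !ler_norml /e4 => /andP[? ?] /andP[? ?].
  by apply/andP; split; lra.
exfalso.
have A0 i : P.-negligible (A i).
  apply/negligibleP => //; apply/eqP; rewrite -measure_le0 leNgt.
  by apply/negP => Ai; apply: noA; exists i.
have cover : [set: Om] `<=`
    ~` [set w | {within `[0, +oo[, continuous (beta ^~ w)}] `|`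
     \bigcup_n (if unpickle n is Some i then A i else set0).
  move=> w _; have [cw|] := pselect {within `[0, +oo[, continuous (beta ^~ w)};
    last by left.
  right; have [N NP] := uniform_modulus K cw e40.
  (* Rounding a height and moving to the grid point each cost e / 4, whence the radius of [A]. The
     successor makes room for the last grid index, so that the default of [nth] is never read. *)
  pose v := mkseq (fun j => Num.floor (beta (j%:R / N.+1%:R) w / e4))
    (Num.trunc (K * N.+1%:R)).+1.
  exists (pickle (N, v)) => //; rewrite pickleK => k.
  have /andP[t0 tK] := tauK k.
  have [/andP[s0 st] ts] := trunc_grid N t0.
  rewrite /x /= nth_mkseq; last first.
    by rewrite ltnS le_truncn// ler_wpM2r.
  set s := _ / _ in s0 st ts *.
  have b1 : `|beta (tau k) w - beta s w| < e4.
    by apply: NP => //; rewrite ?t0 ?tK// s0 (le_trans st).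
  have := floor_itv (beta s w / e4).
  rewrite intrD ler_pdivlMr// ltr_pdivrMr// => /andP[f1 f2].
  rewrite [X in _ - X]mulrC.
  move: b1; rewrite ltr_norml ler_norml => /andP[? ?].
  by apply/andP; split; lra.
have negT : P.-negligible setT.
  apply: negligibleS cover _; apply: negligibleU; first exact: cb.
  apply: negligible_bigcup => n; case: unpickle => [i|]; first exact: A0.
  exact: negligible_set0.
have /eqP := measure_negligible measurableT negT.
by rewrite [X in X == _](probability_setT P) onee_eq0.
Qed.

Hypothesis gauss : gaussian_process beta.
Hypothesis mean0 : forall t, 0 <= t -> ('E_P[beta t] = 0)%E.

Lemma gaussian_comb (c tau : nat -> R) (n : nat) (a : 'I_n -> R) :
  (forall k, 0 <= tau k) ->
  normally_distributed P (fun w => \sum_(i < n) a i * (c i * beta (tau i) w)) /\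
  (\int[P]_w (\sum_(i < n) a i * (c i * beta (tau i) w))%:E = 0)%E.
Proof.
move=> tau0.
have E w : \sum_(i < n) a i * (c i * beta (tau i) w) =
    \sum_(i < n) (a i * c i) * beta (tau i) w.
  by apply: eq_bigr => i _; rewrite mulrA.
split.
  by under eq_fun do rewrite E; apply: gauss => i; exact: tau0.
under eq_integral do rewrite E -sumEFin.
(* The vanishing expectation already yields integrability. *)
have int t : 0 <= t -> P.-integrable setT (EFin \o beta t).
  by move=> /mean0; rewrite unlock => b0; exact: integral0_integrable.
rewrite integral_sum//; last first.
  move=> i; under eq_fun do rewrite EFinM.
  by apply: integrableZl => //; exact: int.
rewrite big1// => i _.
under eq_integral do rewrite EFinM.
rewrite integralZl//; last exact: int.
have := mean0 (tau0 i); rewrite unlock => ->.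
by rewrite mule0.
Qed.

(** Capping by [K] makes every pair (p, q) a legitimate time, so that the times can be enumerated
    without side condition. *)
Lemma grid_dense (K t e : R) : 0 < K -> 0 <= t <= K -> 0 < e ->
  exists p q : nat, `|Num.min K (p%:R / q.+1%:R) - t| < e.
Proof.
move=> K0 /andP[t0 tK] e0.
have [q _ qe] := near_infty_natSinv_lt (PosNum e0).
have [/andP[s0 st] ts] := trunc_grid q t0.
exists (Num.trunc (t * q.+1%:R)), q.
rewrite min_r ?(le_trans st)// distrC (le_lt_trans ts)//.
exact: (qe q (leqnn q)).
Qed.

(** The event [E] involves countably many times, hence is measurable; continuity of the path extends
    the bound to all of [0, K]. *)
Lemma gaussian_small_ball (K a : R) : 0 < K -> 0 < a ->
  {ae P, forall w, {within `[0, +oo[, continuous (beta ^~ w)}} ->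
  exists E : set Om, [/\ measurable E, (0 < P E)%E &
    forall w, E w -> {within `[0, +oo[, continuous (beta ^~ w)} ->
      forall t, 0 <= t <= K -> `|beta t w| <= a].
Proof.
move=> K0 a0 cb; have pi0 := @pi_gt0 R.
(* An index codes (m, p, q): the halving 2^-m and the time min (K, p / (q + 1)). Numbers that code
   no triple default to (0, 0, 0). *)
pose idx k : nat * nat * nat := odflt (0, 0, 0)%N (unpickle k).
pose tau k := Num.min K ((idx k).1.2%:R / (idx k).2.+1%:R).
(* With this scale, |th beta_t| <= pi / 2 means |beta_t| <= a. As |c k| <= th, oscillations of at
   most 1 / th on [A] keep the copies of [X k] within 1 of each other. *)
pose th := pi / 2 / a; have th0 : 0 < th by rewrite !divr_gt0.
pose c k := 2 ^- (idx k).1.1 * th.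
have tauK k : 0 <= tau k <= K.
  by rewrite le_min ge_min lexx (ltW K0) divr_ge0.
have tau0 k : 0 <= tau k by case/andP: (tauK k).
have [A [mA PA AP]] := continuous_ball_gt0 tauK (divr_gt0 ltr01 th0) cb.
pose X k w := c k * beta (tau k) w.
have mX k : measurable_fun setT (X k) by exact: measurable_funM.
pose E := [set w | forall k, 0 <= cos (X k w)].
have mE : measurable E by exact: measurable_forall_cos_ge0.
exists E; split => //.
  apply: lt_le_trans (gaussian_copies_le mX _); last first.
    by move=> n b; exact: (gaussian_comb c b tau0).
  have -> : (0 = 0 * 0 :> \bar R)%E by rewrite mule0.
  have PAA : ((P \x P) (A `*` A) = P A * P A)%E by rewrite product_measure1E.
  apply: (@lt_le_trans _ _ ((P \x P)%E (A `*` A))).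
    by rewrite PAA mule0 mule_gt0.
  apply: le_measure; rewrite ?inE.
  - exact: measurableX.
  - apply: (measurable_forall_norm_le (W := fun k w => X k w.1 - X k w.2)).
    move=> k; apply: measurable_funB.
      exact: (measurableT_comp (mX k) measurable_fst).
    exact: (measurableT_comp (mX k) measurable_snd).
  - move=> [w w'] [/= Aw Aw'] k; rewrite /X -mulrBr normrM.
    have cth : `|c k| <= th.
      rewrite /c normrM (gtr0_norm th0) ger_pMl// normfV normrX normr_nat.
      by rewrite invf_le1 ?exprn_gt0// exprn_ege1// ler1n.
    apply: (@le_trans _ _ (th * (1 / th))); last first.
      by rewrite mulrC divfK// gt_eqF.
    by apply: ler_pM => //; exact: AP.
move=> w Ew cw.
have grid p q : `|beta (Num.min K (p%:R / q.+1%:R)) w| <= a.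
  set t := Num.min _ _.
  have : `|th * beta t w| <= pi / 2.
    apply: norm_le_pihalf => m.
    have := Ew (pickle (m, p, q)).
    by rewrite /= /X /c /tau /idx pickleK /= -mulrA.
  rewrite normrM (gtr0_norm th0) /th mulrAC ler_pdivrMr//.
  by rewrite ler_pM2l// divr_gt0.
move=> t tK; rewrite leNgt; apply/negP => ta.
have e0 : 0 < `|beta t w| - a by rewrite subr_gt0.
have At : `[0, +oo[%classic t by rewrite /= in_itv/= andbT; case/andP: tK.
have [r r0 rP] := continuous_within_dist cw At e0.
have [p [q pq]] := grid_dense K0 tK r0.
have As : `[0, +oo[%classic (Num.min K (p%:R / q.+1%:R)).
  by rewrite /= in_itv/= andbT le_min (ltW K0) divr_ge0.
have := rP _ As pq; apply/negP; rewrite -leNgt.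
rewrite (le_trans _ (ler_dist_dist _ _))// distrC.
by rewrite (le_trans _ (ler_norm _))// lerB// grid.
Qed.

End continuous_gaussian.

(** * The amplitude equation *)

Section pathwise.
Context {R : realType}.
Notation mu := (@lebesgue_measure R).

Lemma within_continuous_comp (A : set R) (g f : R -> R) :
  continuous g -> {within A, continuous f} -> {within A, continuous (g \o f)}.
Proof. by move=> cg cf x; apply: (cvg_comp f g (cf x)); exact: cg. Qed.

Lemma continuous_cubic (k l : R) : continuous (fun x : R => l * x + k * x ^+ 3).
Proof.
move=> x; apply: cvgD; apply: cvgM;
  [exact: cvg_cst|exact: cvg_id|exact: cvg_cst|].
exact: exprn_continuous.
Qed.

Lemma derive1_cube (k : R) :
  (fun x : R => k * x ^+ 3)^`()%classic = fun x => 3 * k * x ^+ 2.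
Proof.
apply/funext => x.
rewrite derive1E deriveM// derive_cst scaler0 addr0 exp_derive.
by rewrite /GRing.scale/= mulr1; ring.
Qed.

Lemma Rintegral_expR (M t : R) : 0 < t ->
  \int[mu]_(r in `[0, t]) (M * expR r) = M * expR t - M.
Proof.
move=> t0; have cM : continuous (fun x : R => M * expR x).
  by move=> x; apply: cvgM; [exact: cvg_cst|exact: continuous_expR].
rewrite /Rintegral (@continuous_FTC2 _ _ (fun x => M * expR x) _ _ t0)//=.
- by rewrite expR0 mulr1.
- exact: continuous_subspaceT.
- split => //.
  + by apply: cvg_at_right_filter; exact: cM.
  + by apply: cvg_at_left_filter; exact: cM.
- move=> x _; rewrite derive1E deriveM// derive_cst scaler0 addr0.
  by have /(congr1 (@^~ x)) := @derive_expR R => /= ->.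
Qed.

Variables (k : R) (T0 : R) (b : R -> R).
Hypothesis k0 : k < 0.
Hypothesis cb : {within `[0, T0], continuous b}.
Let f (x : R) := k * x ^+ 3.

(* At the first time t where |b| reaches M e^t, the equation and the bound
   |b + f b| <= |b| before t give |b t| <= |b0| + a + M (e^t - 1) < M e^t. *)
Lemma path_bound (a b0 M : R) (zeta : R -> R) :
  0 <= a -> `|b0| + a < M -> - k * (M * expR T0) ^+ 2 <= 1 ->
  (forall t, 0 <= t <= T0 -> `|zeta t| <= a) ->
  (forall t, 0 <= t <= T0 ->
     b t = b0 + \int[mu]_(r in `[0, t]) (b r + f (b r)) + zeta t) ->
  forall t, 0 <= t <= T0 -> `|b t| < M * expR t.
Proof.
move=> a0 aM kM za be; have M0 : 0 < M by rewrite (le_lt_trans _ aM)// addr_ge0.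
pose S := [set t | 0 <= t <= T0 /\ M * expR t <= `|b t|].
suff S0 : S = set0.
  move=> t tT; rewrite ltNge; apply/negP => bt.
  by have : S t by []; rewrite S0.
apply/eqP/negP => /negP /set0P Sn0.
have lbS : lbound S 0 by move=> t [/andP[]].
have hS : has_inf S by split => //; exists 0.
pose t := inf S.
have t0 : 0 <= t by exact: lb_le_inf.
have tT : t <= T0.
  have [s Ss] := Sn0; have [/andP[_ sT] _] := Ss.
  by apply: le_trans sT; apply: ge_inf => //; exists 0.
have t0T : 0 <= t <= T0 by rewrite t0.
have below s : 0 <= s < t -> `|b s| < M * expR s.
  move=> /andP[s0 st]; rewrite ltNge; apply/negP => bs.
  have : S s by split => //; rewrite s0 (le_trans (ltW st)).
  by move=> /(ge_inf (ex_intro _ 0 lbS)); rewrite leNgt st.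
(* Otherwise continuity would keep |b| below M e^t just after t, hence below the increasing barrier,
   although [S] has points arbitrarily close to its infimum. *)
have bt : M * expR t <= `|b t|.
  rewrite leNgt; apply/negP => bt.
  have e0 : 0 < M * expR t - `|b t| by rewrite subr_gt0.
  have tI : `[0, T0]%classic t by rewrite /= in_itv.
  have [r r0 rP] := continuous_within_dist cb tI e0.
  have [s Ss sr] := inf_adherent r0 hS.
  have ts : t <= s by apply: ge_inf => //; exists 0.
  case: Ss => sT; apply/negP; rewrite -ltNge.
  have : `|b s - b t| < M * expR t - `|b t|.
    by apply: rP; [rewrite /= in_itv|rewrite ger0_norm ?subr_ge0// ltrBlDl].
  have : M * expR t <= M * expR s by rewrite ler_pM2l// ler_expR.
  have := ler_normD (b s - b t) (b t); rewrite subrK; lra.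
have cbt : {within `[0, t], continuous b}.
  apply: continuous_subspaceW cb => s /=.
  by rewrite !in_itv/= => /andP[-> /le_trans]; apply.
have ch : {within `[0, t], continuous (fun r => b r + f (b r))}.
  rewrite (_ : (fun r => _) = (fun x => 1 * x + k * x ^+ 3) \o b).
    exact: (within_continuous_comp (@continuous_cubic k 1) cbt).
  by apply/funext => r /=; rewrite mul1r.
have ih : mu.-integrable `[0, t] (EFin \o (fun r => b r + f (b r))).
  by apply: continuous_compact_integrable => //; exact: segment_compact.
have iM : mu.-integrable `[0, t] (EFin \o (fun r => M * expR r)).
  apply: continuous_compact_integrable; first exact: segment_compact.
  apply: continuous_subspaceT => x.
  by apply: cvgM; [exact: cvg_cst|exact: continuous_expR].
have hint : `|\int[mu]_(r in `[0, t]) (b r + f (b r))| <= M * expR t - M.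
  move: t0; rewrite le_eqVlt => /predU1P[<-|t0].
    by rewrite set_itv1 Rintegral_set1 normr0 expR0 mulr1 subrr.
  (* The strict bound is known only before t, so the endpoint, which is Lebesgue-null, is dropped
     from both integrals. *)
  have sub : `[0, t[ `<=` `[0, t].
    by move=> s; rewrite /= !in_itv/= => /andP[-> /ltW].
  have ih' : mu.-integrable `[0, t[ (EFin \o (fun r => b r + f (b r))).
    by apply: integrableS ih => //; exact: measurable_itv.
  have iM' : mu.-integrable `[0, t[ (EFin \o (fun r => M * expR r)).
    by apply: integrableS iM => //; exact: measurable_itv.
  rewrite -Rintegral_expR// -!Rintegral_itv_bndo_bndc//.
  rewrite (le_trans (le_normr_Rintegral _ ih'))//.
  apply: le_Rintegral => //.
    exact: integrable_norm ih'.
  move=> r; rewrite /= in_itv/= => rt; have br := below r rt.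
  case/andP: rt => r0 rt.
  rewrite (le_trans _ (ltW br))// /f.
  (* Below the barrier the factor 1 + k b^2 lies in [0, 1]. *)
  have -> : b r + k * b r ^+ 3 = b r * (1 + k * b r ^+ 2) by ring.
  rewrite normrM ler_piMr// ler_norml.
  have kb : - k * b r ^+ 2 <= 1.
    rewrite (le_trans _ kM)// ler_pM2l ?oppr_gt0// -real_normK ?num_real//.
    rewrite ler_pXn2r ?nnegrE ?normr_ge0 ?mulr_ge0 ?expR_ge0 ?(ltW M0)//.
    by rewrite (le_trans (ltW br))// ler_pM2l// ler_expR (le_trans (ltW rt)).
  have kb0 : k * b r ^+ 2 <= 0 by rewrite mulr_le0_ge0 ?sqr_ge0// ltW.
  by apply/andP; split; lra.
have := bt; rewrite be// leNgt => /negP; apply.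
have z := za _ t0T.
rewrite (le_lt_trans (ler_normD _ _))//.
have := ler_normD b0 (\int[mu]_(r in `[0, t]) (b r + f (b r))); lra.
Qed.

(** The derivative 3 k b^2 is at least -3/4 along the path, which leaves 1 - 3/4 for the
    exponent. *)
Lemma lyapunov_ge (rho T : R) : 0 < T <= T0 -> - k * rho ^+ 2 <= 1 / 4 ->
  (forall t, 0 <= t <= T -> `|b t| <= rho) ->
  1 / 4 <= lyapunov f T b.
Proof.
move=> /andP[T_gt0 TT0] krho brho; rewrite /lyapunov expRK.
have df : f^`()%classic = fun x => 3 * k * x ^+ 2 by exact: derive1_cube.
rewrite [T^-1 * _]mulrC ler_pdivlMr//.
have ib : mu.-integrable `[0, T] (EFin \o (fun r => f^`()%classic (b r))).
  apply: continuous_compact_integrable; first exact: segment_compact.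
  apply: (@within_continuous_comp _ (f^`()%classic)).
    by rewrite df => x; apply: cvgM; [exact: cvg_cst|exact: exprn_continuous].
  apply: continuous_subspaceW cb => s /=.
  by rewrite !in_itv/= => /andP[-> /le_trans]; apply.
suff : - (3 / 4) * T <= \int[mu]_(r in `[0, T]) f^`()%classic (b r) by lra.
have -> : - (3 / 4) * T = \int[mu]_(r in `[0, T]) cst (- (3 / 4)) r.
  have muT : mu `[0, T] = T%:E.
    have := @lebesgue_measure_itv R `[0, T].
    by rewrite /= lte_fin T_gt0 -EFinD subr0.
  by rewrite Rintegral_cst//; congr (_ * _); exact: (esym (congr1 fine muT)).
apply: le_Rintegral => //.
  apply: continuous_compact_integrable; first exact: segment_compact.
  by apply: continuous_subspaceT => x; exact: cvg_cst.
move=> r; rewrite /= in_itv/= => /brho br; rewrite df.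
have : - k * b r ^+ 2 <= 1 / 4.
  rewrite (le_trans _ krho)// ler_pM2l ?oppr_gt0// -real_normK ?num_real//.
  by rewrite ler_pXn2r ?nnegrE// (le_trans _ br).
lra.
Qed.

End pathwise.

(** * Measurability of path integrals and of the Lyapunov exponent *)

Section measurability.
Context {R : realType} {d : measure_display} {Om : measurableType d}.
Notation mu := (@lebesgue_measure R).
Variables (T : R) (h : R -> Om -> R).
Hypothesis mh : forall r, measurable_fun setT (h r).
Hypothesis ch : forall w, {within `[0, T], continuous (h ^~ w)}.

(** The process frozen at the left endpoint of each grid cell: a finite sum of products, hence
    jointly measurable. By continuity of the paths it converges pointwise to [h]. *)
Let step (n : nat) (u : R * Om) : R :=
  \sum_(j < (Num.trunc (T * n.+1%:R)).+1)
    \1_(`[j%:R / n.+1%:R, j.+1%:R / n.+1%:R[%classic : set R) u.1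
      * h (j%:R / n.+1%:R) u.2.

Let stepE n r w : 0 <= r <= T ->
  step n (r, w) = h ((Num.trunc (r * n.+1%:R))%:R / n.+1%:R) w.
Proof.
move=> /andP[r0 rT]; have n0 : 0 < n.+1%:R :> R by rewrite ltr0n.
have rn0 : 0 <= r * n.+1%:R by rewrite mulr_ge0// ltW.
have jP : (Num.trunc (r * n.+1%:R) < (Num.trunc (T * n.+1%:R)).+1)%N.
  by rewrite ltnS le_truncn// ler_wpM2r// ltW.
rewrite /step (bigD1 (Ordinal jP))//= big1 ?addr0.
  rewrite indicE mem_set ?mul1r//= in_itv/= ler_pdivrMr// ltr_pdivlMr//.
  exact: truncn_itv.
move=> i /eqP ij; rewrite indicE memNset ?mul0r//= in_itv/=.
rewrite ler_pdivrMr// ltr_pdivlMr// => /truncn_def ri.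
by apply: ij; apply/val_inj => /=.
Qed.

Lemma measurable_path_process :
  measurable_fun (`[0, T] `*` [set: Om]) (fun u : R * Om => h u.1 u.2).
Proof.
apply: (@measurable_fun_cvg _ _ _ _ step).
- move=> n; apply/measurable_funTS; apply: measurable_sum => j.
  apply: measurable_funM; last exact: (measurableT_comp (mh _) measurable_snd).
  exact: (measurableT_comp (measurable_indic _) measurable_fst).
- move=> [r w] [/= rT _]; move: rT; rewrite in_itv/= => rT.
  under eq_fun do rewrite stepE//.
  apply/cvgrPdist_lt => e e0.
  have rI : `[0, T]%classic r by rewrite /= in_itv.
  have [rho rho0 rhoP] := continuous_within_dist (@ch w) rI e0.
  near=> n; have /andP[r0 rleT] := rT.
  have [/andP[s0 sr] rs] := trunc_grid n r0.
  rewrite distrC; apply: rhoP; first by rewrite /= in_itv/= s0 (le_trans sr).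
  rewrite distrC (le_lt_trans rs)//.
  by near: n; exact: (near_infty_natSinv_lt (PosNum rho0)).
Unshelve. all: by end_near. Qed.

(** After extension by 0 outside [0, T], Tonelli's theorem gives measurability of the integrals of
    the positive and negative parts. *)
Lemma measurable_path_integral :
  measurable_fun setT (fun w => \int[mu]_(r in `[0, T]) h r w).
Proof.
pose D := (`[0, T] : set R) `*` [set: Om].
pose G := (EFin \o (fun u : R * Om => h u.1 u.2)) \_ D.
have mG : measurable_fun setT G.
  apply/(measurable_restrictT _ _).1.
    by apply: measurableX.
  apply/measurable_EFinP; exact: measurable_path_process.
rewrite /Rintegral; apply: measurableT_comp => //.
have E w : (\int[mu]_(r in `[0%R, T]) (h r w)%:E =
   \int[mu]_r G^\+ (r, w) - \int[mu]_r G^\- (r, w))%E.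
  rewrite integral_mkcond.
  have -> : (fun r => (h r w)%:E) \_ `[0, T] = (fun r => G (r, w)).
    apply/funext => r; rewrite /G !patchE /D.
    by congr (if _ then _ else _); apply/idP/idP; rewrite !inE /= => -[].
  rewrite integralE; congr (_ - _)%E; apply: eq_integral => r _.
    by rewrite !funeposE.
  by rewrite !funenegE.
under eq_fun do rewrite E.
apply: emeasurable_funB.
- apply: (@measurable_fun_fubini_tonelli_G _ _ _ _ _ mu G^\+%E) => //.
  exact: measurable_funepos.
- apply: (@measurable_fun_fubini_tonelli_G _ _ _ _ _ mu G^\-%E) => //.
  exact: measurable_funeneg.
Qed.

End measurability.

Lemma measurable_lyapunov_ge (R : realType) d (Om : measurableType d)
    (k T0 T c : R) (b : R -> Om -> R) :
  (forall r, measurable_fun setT (b r)) ->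
  (forall w, {within `[0, T0], continuous (b ^~ w)}) -> T <= T0 ->
  measurable [set w | c <= lyapunov (fun x => k * x ^+ 3) T (b ^~ w)].
Proof.
move=> mb cb TT0.
have cf : continuous ((fun x : R => k * x ^+ 3)^`()%classic).
  rewrite derive1_cube => x.
  by apply: cvgM; [exact: cvg_cst|exact: exprn_continuous].
rewrite (_ : [set w | _] =
  (fun w => T^-1 * (T + \int[lebesgue_measure]_(r in `[0, T])
     (fun x => k * x ^+ 3)^`()%classic (b r w))) @^-1` `[c, +oo[); last first.
  by apply/seteqP; split => w; rewrite /= in_itv/= andbT /lyapunov expRK.
rewrite -[X in measurable X]setTI.
suff mI : measurable_fun setT (fun w => \int[lebesgue_measure]_(r in `[0, T])
    (fun x => k * x ^+ 3)^`()%classic (b r w)).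
  by apply: measurable_funM => //; exact: measurable_funD.
apply: measurable_path_integral => [r|w].
  by apply: measurableT_comp => //; exact: continuous_measurable_fun.
apply: (@within_continuous_comp _ _
  ((fun x : R => k * x ^+ 3)^`()%classic) (b ^~ w)) => //.
apply: continuous_subspaceW (cb w) => s /=.
by rewrite !in_itv/= => /andP[-> /le_trans]; apply.
Qed.

Theorem lemma4p1 (R : realType)
  (V : completeNormedModType R) (dot : {dot V for idfun})
  (hV : is_hilbert dot) (sepV : separable V)
  (D : set V) (A : V -> V) (S : R -> {linear V -> V})
  (linA : linear_operator D A)
  (symA : symmetric_operator dot D A)
  (npA : nonpositive_operator dot D A)
  (genA : generates D A S)
  (cptS : compact_semigroup S)
  (anaS : analytic_semigroup S)
  (X : completeNormedModType R) (j : {linear X -> V}) (al : R)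
  (hal : 0 < al < 1 / 2)
  (hX : interpolates dot S al j)
  (e : X) (he : kernel_unit_vector D A j e)
  (F : X -> X -> X -> X -> R)
  (triF : trilinear_to_dual F)
  (dissF : strongly_dissipative F)
  (d : measure_display) (Om : measurableType d) (P : probability Om R)
  (H : R) (hH : 0 < H < 1)
  (beta : R -> {RV P >-> R})
  (hbeta : fractional_brownian_motion H beta)
  (T0 : R) (hT0 : 0 < T0)
  (nu sigma : R -> R)
  (nu_gt0 : forall ep : R, 0 < ep -> 0 < nu ep)
  (sigma_gt0 : forall ep : R, 0 < ep -> 0 < sigma ep)
  (nuO : bigO_eps nu (fun ep => ep ^+ 2))
  (sigmaO : bigO_eps sigma (fun ep => ep `^ (2 * H + 1)))
  (sigmanuO : bigO_eps (fun ep => sigma ep * nu ep `^ (- (1 / 2) - H))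
                       (fun=> 1)) :
  exists2 eta : R, 0 < eta &
    forall (ep : R) (b0 : R) (b : R -> {RV P >-> R}),
      0 < ep -> `|b0| < eta ->
      solution (Fc F e) (sigma ep / nu ep `^ (1 / 2 + H)) b0 T0
        (fun T w => rescale H (nu ep `^ H) (beta ^~ w) T) b ->
      forall T : R, 0 < T <= T0 ->
        (0 < P [set w | (1 / 4 <= lyapunov (Fc F e) T (b ^~ w))%R])%E.

Proof.
have e0 : e != 0.
  apply/eqP => e0; have [] := he.
  by rewrite e0 linear0 normr0 => /eqP; rewrite eq_sym oner_eq0.
pose k := F e e e e; have k0 : k < 0 by exact: Fc1_lt0.
have FcE : Fc F e = fun x => k * x ^+ 3.
  by apply/funext => x; rewrite Fc_cubic.
(* The radius at which - k rho^2 = 1/4, as [lyapunov_ge] demands. *)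
pose rho := (2 * Num.sqrt (- k))^-1.
have sk0 : 0 < Num.sqrt (- k) by rewrite sqrtr_gt0 oppr_gt0.
have rho0 : 0 < rho by rewrite invr_gt0 mulr_gt0.
have krho : - k * rho ^+ 2 <= 1 / 4.
  rewrite /rho exprVn exprMn sqr_sqrtr ?oppr_ge0 ?(ltW k0)// invfM mulrCA mulfV.
    by rewrite mulr1 div1r expr2 -natrM.
  by rewrite oppr_eq0 lt_eqF.
(* The barrier M e^t reaches [rho] exactly at time [T0]. *)
pose M := rho / expR T0; have M0 : 0 < M by rewrite divr_gt0 ?expR_gt0.
have ME : M * expR T0 = rho by rewrite /M divfK// gt_eqF ?expR_gt0.
(* M / 2 for the initial condition and M / 4 for the noise stay below M in total. The choice depends
   on [k] and [T0] only, not on [ep]. *)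
exists (M / 2); first by rewrite divr_gt0.
move=> ep b0 b ep0 b0M [cb solb] T /andP[T_gt0 TT0]; rewrite FcE in solb *.
have [gauss mean0 _ cbeta] := hbeta.
pose g := nu ep `^ H; have g0 : 0 < g by rewrite powR_gt0 ?nu_gt0.
pose s := sigma ep / nu ep `^ (1 / 2 + H).
have s0 : 0 < s.
  by apply: divr_gt0; [exact: sigma_gt0|apply: powR_gt0; exact: nu_gt0].
pose cc := s * g `^ (2 * H).
have cc0 : 0 < cc by apply: mulr_gt0 => //; exact: powR_gt0.
have g2 : 0 < g ^- 2 by rewrite invr_gt0 exprn_gt0.
(* Rescaling time sends [0, T0] to [0, T0 / g^2], and [cc] is the total factor in front of beta: the
   small ball must have radius M / 4 / cc on that interval. *)
have K0 : 0 < T0 * g ^- 2 by exact: mulr_gt0.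
have a0 : 0 < M / 4 / cc by apply: divr_gt0 => //; exact: divr_gt0.
have [E [mE PE EP]] := gaussian_small_ball gauss mean0 K0 a0 cbeta.
set L := [set w | _].
have mL : measurable L.
  exact: (@measurable_lyapunov_ge R _ _ k T0 T (1 / 4) (fun r w => b r w)).
(* [N] gathers the discontinuous noise paths and the failures of the equation; [E] lies in [L] only
   up to this null set. *)
have [N [mN PN NP]] := negligibleU cbeta solb.
have EL : E `<=` L `|` N.
  move=> w Ew; have [Nw|Nw] := pselect (N w); [by right|left].
  have cw : {within `[0, +oo[, continuous (beta ^~ w)}.
    by apply: contrapT => cw; apply: Nw; apply: NP; left.
  have sw : solves_path (fun x => k * x ^+ 3) s b0 T0
      (fun T => rescale H g (beta ^~ w) T) (b ^~ w).
    by apply: contrapT => sw; apply: Nw; apply: NP; right.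
  have bound t : 0 <= t <= T0 -> `|b t w| < M * expR t.
    apply: (path_bound k0 (cb w) (a := M / 4) (b0 := b0)
      (zeta := fun t => s * rescale H g (beta ^~ w) t)).
    - by rewrite divr_ge0// ltW.
    - lra.
    - by rewrite ME (le_trans krho)//; lra.
    - move=> u /andP[u0 uT]; rewrite /rescale mulrA -/cc normrM (gtr0_norm cc0).
      rewrite mulrC -ler_pdivlMr// EP//.
      by rewrite mulr_ge0 ?(ltW g2)//= ler_pM2r.
    - by move=> u uT; exact: sw.
  apply: (lyapunov_ge k0 (cb w) (rho := rho)) => //; first by rewrite T_gt0.
  move=> t /andP[t0 tT]; have tT0 := le_trans tT TT0.
  rewrite (le_trans (ltW (bound t _))) ?t0//.
  by rewrite -ME ler_pM2l// ler_expR.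
apply: (lt_le_trans PE); rewrite (@le_trans _ _ (P (L `|` N)))//.
  by apply: le_measure; rewrite ?inE//; exact: measurableU.
by apply: (le_trans (measureU2 _ mL mN)); rewrite [X in (_ + X <= _)%E]PN adde0.
Qed.
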